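(* Let $f,g:\mathbb{C}\to\mathbb{C}$ be polynomials of the form $f(z)=z+z^2+O(z^3)$ and $g(w)=w-w^2+O(w^3)$ (as $z\to0$, $w\to0$), and let $P:\mathbb{C}^2\to\mathbb{C}^2$ be defined by $P(z,w)=\left(f(z)+\frac{\pi^2}{4}w,\,g(w)\right)$. As $n\to+\infty$, the sequence of maps $$\mathbb{C}^2\ni(z,w)\mapsto P^{\circ(2n+1)}\bigl(z,g^{\circ n^2}(w)\bigr)\in\mathbb{C}^2$$ converges locally uniformly in $\mathcal{B}_f\times\mathcal{B}_g$ to the map $$\mathcal{B}_f\times\mathcal{B}_g\ni(z,w)\mapsto\bigl(\mathcal{L}_f(z),0\bigr)\in\mathbb{C}\times\{0\}.$$
   Context: For $h\in\{f,g\}$, the parabolic basin of $0$ is $\mathcal{B}_h:=\{z\in\mathbb{C}: h^{\circ n}(z)\to0 \text{ as } n\to+\infty,\ h^{\circ n}(z)\ne0 \text{ for all } n\}$. Write $f(z)=z+z^2+az^3+O(z^4)$ with $a\in\mathbb{C}$. Let $\log$ be the branch of the logarithm on $\mathbb{C}\setminus\mathbb{R}^-$ vanishing at $1$. The attracting Fatou coordinate is the holomorphic map $\phi_f:\mathcal{B}_f\to\mathbb{C}$ satisfying $\phi_f\circ f=\phi_f+1$, normalized by $\phi_f(z)=-\frac1z-(1-a)\log\left(-\frac1z\right)+o(1)$ as $\mathrm{Re}(-1/z)\to+\infty$. The repelling Fatou parameterization is the holomorphic map $\psi_f:\mathbb{C}\to\mathbb{C}$ satisfying $\psi_f(Z+1)=f(\psi_f(Z))$,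 normalized by $-\frac{1}{\psi_f(Z)}=Z+(1-a)\log(-Z)+o(1)$ as $\mathrm{Re}(Z)\to-\infty$. The (phase $0$) Lavaurs map is $\mathcal{L}_f:=\psi_f\circ\phi_f:\mathcal{B}_f\to\mathbb{C}$. *)

(* Defs.v *)
From HB Require Import structures.
From mathcomp Require Import all_boot all_order all_algebra.
From mathcomp Require Import all_classical all_reals all_analysis.
From mathcomp Require Import ring lra.
From mathcomp Require Import complex.

Set Implicit Arguments.
Unset Strict Implicit.
Unset Printing Implicit Defensive.

Import Order.TTheory GRing.Theory Num.Theory.
Import numFieldNormedType.Exports.

Local Open Scope classical_set_scope.
Local Open Scope ring_scope.
Local Open Scope complex_scope.

(* [R[i]] seen as a [numClosedFieldType]: [R[i]] itself is an [lmodType] over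
   [R], whereas complex differentiability needs the topology and the normed
   module structure of [R[i]] over itself, which this type inherits from the
   generic instances. *)
Definition Cplx (R : realType) : numClosedFieldType := R[i].

Section Exp_log.
Variable R : realType.
Local Notation C := (Cplx R).
Local Notation Re := (@complex.Re R).
Local Notation Im := (@complex.Im R).

Definition expC (z : C) : C :=
  (expR (Re z) * cos (Im z)) +i* (expR (Re z) * sin (Im z)).

(* The plane cut along the half-line of nonpositive reals. *)
Definition slit_plane : set C := [set z | Im z != 0 \/ 0 < Re z].

(* On the slit plane the half-angle formula
   arg z = 2 arctan (Im z / (|z| + Re z)) gives the argument in ]-pi, pi[.
   The lemmas below show that this is the branch vanishing at 1. *)
Definition logC (z : C) : C :=
  let r := Num.sqrt (Re z ^+ 2 + Im z ^+ 2) in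
  ln r +i* (2 * atan (Im z / (r + Re z))).

Lemma logC1 : logC 1 = 0.
Proof.
by rewrite /logC /= expr0n addr0 expr1n sqrtr1 ln1 mul0r atan0 mulr0.
Qed.

Let slit_denom (z : C) : slit_plane z ->
  0 < Num.sqrt (Re z ^+ 2 + Im z ^+ 2) + Re z.
Proof.
case: z => x y; rewrite /slit_plane /=.
set r := Num.sqrt _ => h.
have r0 : 0 <= r by rewrite sqrtr_ge0.
have r2 : r ^+ 2 = x ^+ 2 + y ^+ 2 by rewrite sqr_sqrtr// addr_ge0 ?sqr_ge0.
case: h => [y0|x0]; last by lra.
have {}y0 : 0 < y ^+ 2 by rewrite exprn_even_gt0.
rewrite ltNge; apply/negP => rx; nra.
Qed.

Let slit_norm (z : C) : slit_plane z -> 0 < Re z ^+ 2 + Im z ^+ 2.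
Proof.
move=> [y0|x0].
  by rewrite ltr_wpDl ?sqr_ge0// exprn_even_gt0.
by rewrite ltr_pwDl ?sqr_ge0// exprn_gt0.
Qed.

Lemma logCK (z : C) : slit_plane z -> expC (logC z) = z.
Proof.
move=> hz; have d0 := slit_denom hz; have n0 := slit_norm hz.
move: d0 n0; case: z {hz} => x y; rewrite /expC /logC /=.
set r := Num.sqrt _ => d0 n0.
have r0 : 0 < r by rewrite sqrtr_gt0.
have r2 : r ^+ 2 = x ^+ 2 + y ^+ 2 by rewrite sqr_sqrtr// ltW.
rewrite lnK ?posrE//.
set t := y / (r + x); set u := atan t.
have c0 : cos u != 0.
  by rewrite gt_eqF// cos_gt0_pihalf// atan_gtNpi2 atan_ltpi2.
have tE : tan u = t by exact: atanK.
have c2 : cos u ^+ 2 * (1 + t ^+ 2) = 1.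
  by rewrite -tE /tan expr_div_n mulrDr mulr1 mulrCA divff ?mulr1 ?cos2Dsin2
     ?expf_neq0.
have sE : sin u = t * cos u by rewrite -tE /tan mulfVK.
have dn : r + x != 0 by rewrite gt_eqF.
have rn : r != 0 by rewrite gt_eqF.
have ty : t * (r + x) = y by rewrite /t divfK.
have tr : (1 + t ^+ 2) * (r + x) = 2 * r.
  apply: (mulIf dn).
  have -> : (1 + t ^+ 2) * (r + x) * (r + x) = (r + x) ^+ 2 + (t * (r + x)) ^+ 2.
    by ring.
  rewrite ty; transitivity (r ^+ 2 + 2 * r * x + (x ^+ 2 + y ^+ 2)); first by ring.
  by rewrite -r2; ring.
have cr : cos u ^+ 2 * (2 * r) = r + x by rewrite -tr mulrA c2 mul1r.
rewrite mulr_natl cos_mulr2n sin_mulr2n sE; congr (_ +i* _).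
  have -> : r * (cos u ^+ 2 *+ 2 - 1) = cos u ^+ 2 * (2 * r) - r by ring.
  by rewrite cr addrAC subrr add0r.
have -> : r * (cos u * (t * cos u) *+ 2) = t * (cos u ^+ 2 * (2 * r)) by ring.
by rewrite cr.
Qed.

Let cvg_Re (z : C) : Re w @[w --> z] --> Re z.
Proof.
apply/(@cvgrPdist_lt _ _ _ (nbhs z)) => e e0; apply/nbhs_ballP.
exists (e%:C : C); first by rewrite /= ltcR.
move=> w; rewrite /ball /= => zw.
rewrite -ltcR; apply: le_lt_trans zw; rewrite -raddfB; exact: normc_ge_Re.
Qed.

Let cvg_Im (z : C) : Im w @[w --> z] --> Im z.
Proof.
have nIm (w : C) : `|Im w|%:C <= `|w| :> R[i].
  case: w => a b; rewrite normc_def /= lecR.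
  by rewrite -sqrtr_sqr ler_wsqrtr// lerDr sqr_ge0.
apply/(@cvgrPdist_lt _ _ _ (nbhs z)) => e e0; apply/nbhs_ballP.
exists (e%:C : C); first by rewrite /= ltcR.
move=> w; rewrite /ball /= => zw.
by rewrite -ltcR; apply: le_lt_trans zw; rewrite -raddfB; exact: nIm.
Qed.

Let cvg_complex (z : C) (h : C -> C) (l : C) :
  Re (h w) @[w --> z] --> Re l -> Im (h w) @[w --> z] --> Im l ->
  h w @[w --> z] --> l.
Proof.
move=> hr hi; apply/(@cvgrPdist_lt _ _ _ (nbhs z)) => e e0.
have [eE d0] : e = (Re e)%:C /\ 0 < Re e / 2.
  move: e0; case: e => a b; rewrite ltcE /= => /andP[/eqP -> a0].
  by rewrite divr_gt0.
have /cvgrPdist_lt/(_ _ d0) Hr := hr.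
have /cvgrPdist_lt/(_ _ d0) Hi := hi.
apply: filterS2 Hr Hi => w.
rewrite eE normc_def ltcR raddfB /= raddfB /=.
set a := Re l - _; set b := Im l - _ => ad bd.
apply: (@le_lt_trans _ _ (`|a| + `|b|)); last by lra.
rewrite -(ger0_norm (addr_ge0 (normr_ge0 a) (normr_ge0 b))) -sqrtr_sqr.
apply: ler_wsqrtr; have := real_normK (num_real a); have := real_normK (num_real b).
have := mulr_ge0 (normr_ge0 a) (normr_ge0 b); nra.
Qed.

Lemma continuous_logC (z : C) : slit_plane z -> {for z, continuous logC}.
Proof.
move=> hz; have d0 := slit_denom hz; have n0 := slit_norm hz.
have cr : Num.sqrt (Re w ^+ 2 + Im w ^+ 2) @[w --> z] -->
    Num.sqrt (Re z ^+ 2 + Im z ^+ 2).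
  apply: (@continuous_cvg _ _ _ (nbhs z)) => /=.
    exact: (@sqrt_continuous R).
  by rewrite !expr2; under eq_fun do rewrite !expr2; apply: cvgD; apply: cvgM;
    (exact: cvg_Re || exact: cvg_Im).
apply: cvg_complex; rewrite /logC /=.
  by apply: (@continuous_cvg _ _ _ (nbhs z)) => //; apply: continuous_ln;
    rewrite sqrtr_gt0.
apply: (@cvgMl_tmp R C (nbhs z)).
apply: (@continuous_cvg _ _ _ (nbhs z)) => /=; first exact: continuous_atan.
apply: cvgM; first exact: cvg_Im.
apply: cvgV; first by rewrite gt_eqF.
by apply: cvgD => //; exact: cvg_Re.
Qed.

End Exp_log.

Section Parabolic.
Variable R : realType.
Local Notation C := (Cplx R).
Local Notation Re := (@complex.Re R).

Definition holomorphic_on (A : set C) (h : C -> C) : Prop :=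
  forall z, A z -> derivable h z 1.

Definition basin (h : {poly C}) : set C :=
  [set z | (fun n => iter n (horner h) z) @ \oo --> (0 : C) /\
           forall n, iter n (horner h) z != 0].

(* [phi] is total; only its values on the basin are constrained. *)
Definition is_attracting_fatou_coordinate (f : {poly C}) (phi : C -> C) : Prop :=
  [/\ holomorphic_on (basin f) phi,
      forall z, basin f z -> phi f.[z] = phi z + 1 &
      forall e : R, 0 < e -> exists M : R, forall z : C,
        basin f z -> M < Re (- z^-1) ->
        `|phi z - (- z^-1 - (1 - f`_3) * logC (- z^-1))| < e%:C].

(* No condition [psi Z != 0] is needed for the division to be meaningful: the
   main term Z + (1 - a) log (- Z) tends to infinity as Re Z -> -oo, so the estimate
   excludes the conventional value 0^-1 = 0. *)
Definition is_repelling_fatou_parameterization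
    (f : {poly C}) (psi : C -> C) : Prop :=
  [/\ holomorphic_on setT psi,
      forall Z, psi (Z + 1) = f.[psi Z] &
      forall e : R, 0 < e -> exists M : R, forall Z : C, Re Z < M ->
        `|- (psi Z)^-1 - (Z + (1 - f`_3) * logC (- Z))| < e%:C].

Definition lavaurs (phi psi : C -> C) : C -> C := psi \o phi.

Definition skew_map (f g : {poly C}) (p : C * C) : C * C :=
  (f.[p.1] + (pi ^+ 2 / 4)%:C * p.2, g.[p.2]).

End Parabolic.

Definition locally_uniform_cvg (X : topologicalType) (Y : uniformType)
    (A : set X) (F : nat -> X -> Y) (G : X -> Y) : Prop :=
  forall x, A x -> exists2 U, nbhs x U & {uniform A `&` U, F @ \oo --> G}.

(* Main.v *)
Require Import Defs.
From HB Require Import structures.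
From mathcomp Require Import all_boot all_order all_algebra.
From mathcomp Require Import all_classical all_reals all_analysis.
From mathcomp Require Import ring lra zify.
From mathcomp Require Import complex.

Set Implicit Arguments.
Unset Strict Implicit.
Unset Printing Implicit Defensive.

Import Order.TTheory GRing.Theory Num.Theory.
Import numFieldNormedType.Exports.

Local Open Scope classical_set_scope.
Local Open Scope ring_scope.

(** The second coordinate decreases like 1/m: if w_m = g^m(w), then 1/w_m = m + O(log m)
    locally uniformly. The first coordinate thus follows z |-> f(z) + c_j for
    0 <= j <= 2 n, with c_j = (pi^2/4) w_(n^2 + j) = (pi^2/4) / (n^2 + j) + small. In the chart
    Z = - 1/z the map f is nearly Z |-> Z + 1, and a constant c > 0 opens a gate between
    the two fixed points that 0 splits into, near + i sqrt c and - i sqrt c, through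
    which orbits coming from the attracting side go to the repelling side in about
    pi / sqrt c steps. Here the average of sqrt c_j is pi / (2 n + 1) up to a negligible
    error, whence exactly 2 n + 1 steps.

    To make this precise without complex trigonometry, the orbit is compared with one
    real orbit, zt_j = - tan t * cot (j t) with t = pi / (2 n + 1), of the Moebius map
    z |-> (z + s) / (1 - z), s = (tan t)^2. Put p_j = sin (j t) / tan t, so that 1 / p_j^2 is
    proportional to the derivative of this orbit, and write z_j = zt_j + e_j / p_j^2.
    Then (gate_step) e_(j+1) = e_j + eta_j + O((1 + |e_j|^2) / p_j^2), where eta_j is
    explicit and of order 1 / p_j. As eta is odd under j |-> 2 n + 1 - j, its effects on
    both halves of the passage cancel, and e_j grows at most like the logarithm of the
    distance to the ends; the errors are summable and e changes by O(1 / sqrt K) between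
    the steps K and 2 n + 1 - K, uniformly in n (gate_passage).

    When K is fixed and n tends to infinity, p_K tends to K and zt_K to - 1/K, and the
    first K steps converge to those of f. The normalisation of phi then says that
    e_K = phi(z) + b log K + o(1) for large K, where 1 - b is the cubic coefficient of f
    (entry_asymptotics). Likewise the normalisation of psi says that a deviation
    X + b log K, K steps before the end, is that of a point close to psi (X - K)
    (exit_asymptotics). The logarithms are the same, so X = phi(z) up to o(1), and K more
    steps of f lead close to psi (phi(z)) because f is nearly an isometry in the chart
    (exit_stability). *)

(* Linear arithmetic over nat in a context full of real inequalities. *)
Ltac nat_lia :=
  repeat match goal with
  | H : is_true (@Order.le _ _ _ _) |- _ => clear H
  | H : is_true (@Order.lt _ _ _ _) |- _ => clear H
  | H : forall _, _ |- _ => clear H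
  end; lia.

(* Linear arithmetic from the order and equality facts of the context alone: the time
   taken by lra grows quickly with the other hypotheses. *)
Ltac order_lra :=
  repeat match goal with
  | H : ?T |- _ =>
    lazymatch T with
    | is_true (@Order.le _ _ _ _) => fail
    | is_true (@Order.lt _ _ _ _) => fail
    | @eq (Real.sort _) _ _ => fail
    | _ => let s := type of T in constr_eq s Prop; clear H
    end
  end; lra.

(** * The real-valued modulus *)

Section Modulus.
Variable R : realType.
Local Notation C := (Cplx R).
Local Notation Re := (@complex.Re R).

(** The norm of R[i] takes its values in R[i]; estimates are carried out in R, where
    linear and nonlinear arithmetic over an ordered field are available. *)
Definition modulus (z : C) : R := Normc.normc z.
Definition rC (x : R) : C := (x%:C)%C.

Local Notation nm := modulus.

Lemma modulusE (z : C) : `|z| = rC (nm z).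
Proof. by case: z. Qed.

Lemma modulus_lt (z : C) (e : R) : (`|z| < rC e) = (nm z < e).
Proof. by rewrite modulusE /rC ltcR. Qed.

Lemma modulus_le (z : C) (e : R) : (`|z| <= rC e) = (nm z <= e).
Proof. by rewrite modulusE /rC lecR. Qed.

Lemma modulusM (x y : C) : nm (x * y) = nm x * nm y.
Proof. exact: Normc.normcM. Qed.

Lemma modulusD (x y : C) : nm (x + y) <= nm x + nm y.
Proof. exact: le_normcD. Qed.

Lemma modulusN (x : C) : nm (- x) = nm x.
Proof. exact: normcN. Qed.

Lemma modulusV (x : C) : nm (x^-1) = (nm x)^-1.
Proof. exact: Normc.normcV. Qed.

Lemma modulus0 : nm 0 = 0.
Proof. exact: Normc.normc0. Qed.

Lemma modulus1 : nm 1 = 1.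
Proof. exact: Normc.normc1. Qed.

Lemma modulus_ge0 (x : C) : 0 <= nm x.
Proof. by case: x => a b; rewrite /nm /= sqrtr_ge0. Qed.

Lemma modulus_eq0 (x : C) : (nm x == 0) = (x == 0).
Proof.
apply/eqP/eqP => [|->]; [exact: Normc.eq0_normc|exact: modulus0].
Qed.

Lemma modulus_gt0 (x : C) : (0 < nm x) = (x != 0).
Proof. by rewrite lt_def modulus_eq0 modulus_ge0 andbT. Qed.

Lemma modulusX (x : C) n : nm (x ^+ n) = nm x ^+ n.
Proof. by elim: n => [|n ih]; rewrite ?expr0 ?modulus1// !exprS modulusM ih. Qed.

Lemma modulusB (x y : C) : nm (x - y) <= nm x + nm y.
Proof. by rewrite -(modulusN y) modulusD. Qed.

Lemma modulus_sym (x y : C) : nm (x - y) = nm (y - x).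
Proof. by rewrite -modulusN opprB. Qed.

Lemma modulus_subr (x y : C) : nm x - nm y <= nm (x - y).
Proof. by rewrite lerBlDr; have := modulusD (x - y) y; rewrite subrK. Qed.

Lemma modulus_addr (x y : C) : nm x - nm y <= nm (x + y).
Proof. by have := modulus_subr x (- y); rewrite opprK modulusN. Qed.

Lemma modulus_tri (y x z : C) : nm (x - z) <= nm (x - y) + nm (y - z).
Proof. by apply: le_trans (modulusD _ _); rewrite addrA subrK. Qed.

Lemma modulus_rC (x : R) : nm (rC x) = `|x|.
Proof. by rewrite /nm /rC /= expr0n addr0 sqrtr_sqr. Qed.

Lemma modulus_ge_Re (z : C) : `|Re z| <= nm z.
Proof. by have := normc_ge_Re z; case: z => a b; rewrite lecR. Qed.

Lemma rCD x y : rC (x + y) = rC x + rC y.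
Proof. exact: rmorphD. Qed.
Lemma rCB x y : rC (x - y) = rC x - rC y.
Proof. exact: rmorphB. Qed.
Lemma rCN x : rC (- x) = - rC x.
Proof. exact: rmorphN. Qed.
Lemma rCM x y : rC (x * y) = rC x * rC y.
Proof. exact: rmorphM. Qed.
Lemma rCX x n : rC (x ^+ n) = rC x ^+ n.
Proof. exact: rmorphXn. Qed.
Lemma rCV x : rC (x^-1) = (rC x)^-1.
Proof. exact: fmorphV. Qed.
Lemma rC1 : rC 1 = 1. Proof. by []. Qed.
Lemma rC_nat n : rC n%:R = n%:R.
Proof. exact: rmorph_nat. Qed.
Lemma rC_eq0 x : (rC x == 0) = (x == 0).
Proof. exact: fmorph_eq0. Qed.
Lemma Re_rC x : Re (rC x) = x. Proof. by []. Qed.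
Lemma ReD (x y : C) : Re (x + y) = Re x + Re y.
Proof. by case: x y => [? ?][? ?]. Qed.
Lemma ReN (x : C) : Re (- x) = - Re x.
Proof. by case: x => [? ?]. Qed.

Lemma nbhs_modulusP (z : C) (P : set C) :
  nbhs z P <-> exists2 e : R, 0 < e & forall w, nm (w - z) < e -> P w.
Proof.
split=> [/nbhs_ballP[e e0 he]|[e e0 he]].
  have [eE e'0] : e = rC (Re e) /\ 0 < Re e.
    by move: e0; case: (e) => a b; rewrite /= ltcE /= => /andP[/eqP -> a0].
  exists (Re e) => // w we; apply: he; rewrite /ball /= distrC eE.
  by rewrite modulus_lt.
apply/nbhs_ballP; exists (rC e); first by rewrite /= /rC ltcR.
by move=> w; rewrite /ball /= distrC modulus_lt; exact: he.
Qed.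

Lemma cvg_modulusP (T : Type) (F : set_system T) (FF : Filter F) (h : T -> C)
  (l : C) :
  h @ F --> l <-> forall e : R, 0 < e -> \forall x \near F, nm (h x - l) < e.
Proof.
split=> [hl e e0|hl].
  by apply: (hl [set w | nm (w - l) < e]); apply/nbhs_modulusP; exists e.
move=> P /nbhs_modulusP[e e0 he].
by rewrite nbhs_filterE; apply: filterS (hl e e0) => x; exact: he.
Qed.

End Modulus.

(** * Polynomials and their germ at the origin *)

Section Polynomials.
Variable R : realType.
Local Notation C := (Cplx R).
Local Notation nm := (@modulus R).

Lemma poly_bounded (p : {poly C}) (B : R) :
  exists2 L : R, 0 <= L & forall z, nm z <= B -> nm p.[z] <= L.
Proof.
elim/poly_ind: p => [|p c [L L0 hL]].
  by exists 0 => // z _; rewrite horner0 modulus0.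
exists (L * `|B| + nm c); first by rewrite addr_ge0 ?mulr_ge0// modulus_ge0.
move=> z zB; rewrite hornerMXaddC; apply: le_trans (modulusD _ _) _.
rewrite modulusM lerD2r ler_pM ?modulus_ge0 ?hL//.
by rewrite (le_trans zB)// ler_norm.
Qed.

Lemma poly_lipschitz (p : {poly C}) (B : R) :
  exists2 L : R, 0 <= L &
    forall u v, nm u <= B -> nm v <= B -> nm (p.[u] - p.[v]) <= L * nm (u - v).
Proof.
elim/poly_ind: p => [|p c [L L0 hL]].
  by exists 0 => // u v _ _; rewrite !horner0 subr0 modulus0 mul0r.
have [M M0 hM] := poly_bounded p B.
exists (L * `|B| + M); first by rewrite addr_ge0 ?mulr_ge0.
move=> u v uB vB; rewrite !hornerMXaddC.
have -> : p.[u] * u + c - (p.[v] * v + c) =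
  (p.[u] - p.[v]) * u + p.[v] * (u - v) by ring.
apply: le_trans (modulusD _ _) _; rewrite !modulusM mulrDl; apply: lerD.
  rewrite mulrAC; apply: ler_pM; rewrite ?modulus_ge0 ?hL//.
  by rewrite (le_trans uB)// ler_norm.
by rewrite ler_wpM2r ?modulus_ge0// hM.
Qed.

(** Induction on k: letting z tend to 0 kills the constant term, and dividing by z
    leaves a polynomial which is O(z^(k-1)). *)
Lemma vanishing_coef (p : {poly C}) (k : nat) (r M : R) : 0 < r ->
  (forall z, 0 < nm z < r -> nm p.[z] <= M * nm z ^+ k) ->
  forall i, (i < k)%N -> p`_i = 0.
Proof.
elim: k p r => // k ih p r r0 hp.
elim/poly_ind: p hp => [|q c _] hp; first by move=> i _; rewrite coef0.
have [L L0 hL] := poly_bounded q 1.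
have M0 : 0 <= M.
  have h : 0 < nm (rC (r / 2)) < r by rewrite modulus_rC gtr0_norm; lra.
  have := le_trans (modulus_ge0 _) (hp _ h).
  by rewrite pmulr_lge0// exprn_gt0//; case/andP: h.
have c0 : c = 0.
  (* at t, |c| <= (M + L) t < |c| *)
  apply/eqP; rewrite -modulus_eq0; apply/negPn/negP => cn.
  have {}cn : 0 < nm c by rewrite lt_def cn modulus_ge0.
  pose t := Num.min (Num.min (r / 2) 1) (nm c / 2 / (M + L + 1)).
  have ML : 0 < M + L + 1 by lra.
  have t0 : 0 < t by rewrite !lt_min ?divr_gt0//; lra.
  have [tr t1 tc] : [/\ t <= r / 2, t <= 1 & t * (M + L + 1) <= nm c / 2].
    by rewrite -ler_pdivlMr// !ge_min !lexx ?orbT.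
  have nt : nm (rC t) = t by rewrite modulus_rC gtr0_norm.
  have ht : 0 < nm (rC t) < r by rewrite nt t0; lra.
  have := hp _ ht; rewrite hornerMXaddC nt => h1.
  have := modulus_subr c (- (q.[rC t] * rC t)).
  rewrite opprK modulusN modulusM nt [c + _]addrC => h2.
  have h3 : nm q.[rC t] * t <= L * t by apply: ler_wpM2r; [exact: ltW|apply: hL; rewrite nt].
  have h4 : M * t ^+ k.+1 <= M * t.
    by rewrite ler_wpM2l// exprS ler_piMr ?(ltW t0)//; apply: exprn_ile1; rewrite ?(ltW t0).
  have h5 : nm c <= (M + L) * t.
    rewrite mulrDl; apply: le_trans (lerD (le_trans h1 h4) h3).
    by rewrite -lerBlDr.
  have : (M + L) * t <= t * (M + L + 1) by rewrite mulrC ler_wpM2l ?(ltW t0)//; lra.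
  by lra.
rewrite c0 in hp *.
have hq i : (i < k)%N -> q`_i = 0.
  apply: ih r0 _ i => z /andP[z0 zr].
  have := hp z; rewrite z0 zr => /(_ isT).
  by rewrite hornerMXaddC addr0 modulusM exprSr mulrA ler_pM2r.
move=> [|i] ik; rewrite coefD coefMX coefC /= addr0//.
exact: hq.
Qed.

Lemma poly_split (p : {poly C}) k :
  p = \sum_(i < k) p`_i *: 'X^i + drop_poly k p * 'X^k.
Proof.
rewrite -[LHS](poly_take_drop k); congr (_ + _).
by apply/polyP => i; rewrite coef_take_poly -poly_def coef_poly.
Qed.

Lemma germ_coef (p q : {poly C}) k :
  (fun z => p.[z]) = (fun z : C => q.[z]) +O_ (0 : C) (fun z => z ^+ k) ->
  forall i, (i < k)%N -> p`_i = q`_i.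
Proof.
move=> /eqaddOP/bigO_exP[M M0 /nbhs_modulusP[r r0 h]] i ik.
apply/eqP; rewrite -subr_eq0 -coefB; apply/eqP.
have ME : M = rC (complex.Re M).
  by move: (M0); case: (M) => a b; rewrite ltcE /= => /andP[/eqP -> _].
apply: (vanishing_coef (M := complex.Re M) r0 _ ik) => z /andP[_ zr].
have := h z; rewrite subr0 => /(_ zr).
rewrite /= ME (modulusE (z ^+ k)) -rCM modulus_le modulusX.
by rewrite hornerD hornerN.
Qed.

(** The expansion is exact because f is a polynomial; its fourth-order remainder is the
    precision needed for the passage through the gate. *)
Lemma parabolic_expansion (f : {poly C}) :
  (fun z => f.[z]) = (fun z : C => z + z ^+ 2) +O_ (0 : C) (fun z => z ^+ 3) ->
  exists k : {poly C}, forall z, f.[z] = z + z ^+ 2 + f`_3 * z ^+ 3 + z ^+ 4 * k.[z].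
Proof.
move=> hf; exists (drop_poly 4 f) => z.
have hc : forall i, (i < 3)%N -> f`_i = ('X + 'X^2 : {poly C})`_i.
  by apply: germ_coef; under [in RHS]eq_fun do rewrite hornerD hornerX hornerXn.
rewrite {1}(poly_split f 4) !big_ord_recl big_ord0 /= /bump /= !add1n.
rewrite (hc 0%N)// (hc 1%N)// (hc 2%N)// !coefD !coefX !coefXn /=.
by rewrite !hornerE /=; ring.
Qed.

End Polynomials.

(** * Orbits in a parabolic basin *)

Section Harmonic.
Variable R : realType.
Implicit Types x : R.

Lemma invS_le_ln x : 0 < x -> (x + 1)^-1 <= ln (x + 1) - ln x.
Proof.
move=> x0; have x1 : 0 < x + 1 by lra.
rewrite -ln_div ?posrE//.
have -> : (x + 1) / x = (x / (x + 1))^-1 by rewrite invf_div.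
rewrite lnV ?posrE ?divr_gt0//.
have -> : x / (x + 1) = 1 + - (x + 1)^-1 by field; lra.
rewrite lerNr; apply: le_ln1Dx.
by rewrite ltrN2 invf_lt1//; lra.
Qed.

Lemma harmonic_le_ln k : \sum_(i < k) (i.+1%:R : R)^-1 <= 1 + ln k.+1%:R.
Proof.
case: k => [|k]; first by rewrite big_ord0 ln1 addr0.
have h : \sum_(i < k.+1) (i.+1%:R : R)^-1 <= 1 + ln k.+1%:R.
  elim: k => [|k ih]; first by rewrite big_ord1 invr1 ln1 addr0.
  rewrite big_ord_recr /=; have := @invS_le_ln k.+1%:R.
  rewrite ltr0n natr1 => /(_ isT) h.
  by apply: le_trans (lerD ih h) _; rewrite -addrA subrKC.
by apply: le_trans h _; rewrite lerD2l ler_ln ?posrE ?ltr0n// ler_nat.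
Qed.

End Harmonic.

Section ParabolicOrbits.
Variable R : realType.
Local Notation C := (Cplx R).
Local Notation Re := (@complex.Re R).
Local Notation nm := (@modulus R).

Lemma poly_iter_lipschitz (p : {poly C}) (B : R) (k : nat) :
  exists L : R, exists2 M : R, 0 <= L &
    forall u v, nm u <= B -> nm v <= B ->
      nm (iter k (horner p) u) <= M /\
      nm (iter k (horner p) u - iter k (horner p) v) <= L * nm (u - v).
Proof.
elim: k => [|k [L [M L0 h]]].
  by exists 1, B => // u v uB vB /=; rewrite mul1r.
have [L1 L10 h1] := poly_lipschitz p M.
have [M1 _ h2] := poly_bounded p M.
exists (L1 * L), M1; first exact: mulr_ge0.
move=> u v uB vB; have [uM uv] := h u v uB vB; have [vM _] := h v u vB uB.
split; first exact: h2.
by apply: le_trans (h1 _ _ uM vM) _; rewrite -mulrA ler_wpM2l.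
Qed.

(** The coordinate in which a parabolic germ z + z^2 + O(z^3) is close to the
    translation by 1. *)
Definition chart (z : C) : C := - z^-1.

Lemma modulus_chart z : nm (chart z) = (nm z)^-1.
Proof. by rewrite /chart modulusN modulusV. Qed.

Lemma chartK : involutive chart.
Proof. by move=> z; rewrite /chart invrN invrK opprK. Qed.

Definition parabolic (F : {poly C}) := exists2 A : R, 0 <= A &
  forall z, nm z <= 1 -> nm (F.[z] - (z + z ^+ 2)) <= A * nm z ^+ 3.

Lemma parabolic_near0 F : parabolic F ->
  exists A : R, exists2 r : R, [/\ 0 < r, r <= 1, 0 <= A & A * r <= 1 / 2] &
  forall z, 0 < nm z <= r ->
    F.[z] != 0 /\ nm (chart F.[z] - (chart z + 1)) <= A * nm z.
Proof.
(* r is such that (4 A + 2) r <= 1/2 *)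
case=> A A0 hA; set r : R := (8 * A + 8)^-1.
have a0 : 0 < 8 * A + 8 by lra.
have r0 : 0 < r by rewrite invr_gt0.
have Ar0 := mulr_ge0 A0 (ltW r0).
have ra : r * (8 * A + 8) = 1 by rewrite mulVf ?gt_eqF.
exists (4 * A + 2), r; first by split; nra.
move=> z /andP[z0 zr]; have z1 : nm z <= 1 by nra.
have zn : z != 0 by rewrite -modulus_gt0.
have := hA z z1; set E := F.[z] - _ => hE.
have FE : F.[z] = z + z ^+ 2 + E by rewrite /E; ring.
have low : nm z / 2 <= nm F.[z].
  have := modulus_addr z (z ^+ 2 + E); rewrite [z + _]addrA -FE.
  have := modulusD (z ^+ 2) E; rewrite modulusX => h1 h2.
  have h3 : A * nm z ^+ 3 <= A * nm z ^+ 2.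
    by rewrite ler_wpM2l// exprS ler_piMl// exprn_ge0// ltW.
  nra.
have Fn : F.[z] != 0 by rewrite -modulus_gt0; lra.
split=> //; rewrite /chart.
have -> : - F.[z]^-1 - (- z^-1 + 1) = (E - z ^+ 3 - z * E) / (z * F.[z]).
  have : z * F.[z] != 0 by rewrite mulf_neq0.
  by rewrite FE => h; field; rewrite -FE Fn.
rewrite modulusM modulusV modulusM ler_pdivrMr; last by rewrite mulr_gt0//; lra.
apply: le_trans (modulusB _ _) _; apply: le_trans (lerD (modulusB _ _) (lexx _)) _.
rewrite modulusM modulusX.
have h3 : nm z * nm E <= A * nm z ^+ 3.
  by apply: le_trans hE; rewrite ler_piMl// modulus_ge0.
have : (2 * A + 1) * nm z ^+ 3 <= (4 * A + 2) * nm z * (nm z * nm F.[z]).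
  have -> : (4 * A + 2) * nm z * (nm z * nm F.[z]) =
    (2 * A + 1) * nm z ^+ 2 * (2 * nm F.[z]) by ring.
  rewrite exprSr mulrA ler_wpM2l; [by []| |by lra].
  by rewrite mulr_ge0 ?exprn_ge0 ?modulus_ge0//; lra.
lra.
Qed.

(** In the chart an orbit moves by 1 + O(1/Z) at each step and its real part by at least
    1/2, so |Z| grows linearly and the errors add up to a harmonic sum. *)
Lemma parabolic_half_plane F : parabolic F ->
  exists2 A : R, 0 <= A & exists2 T : R, 1 <= T & forall z, T <= Re (chart z) ->
    forall k, Re (chart z) + k%:R / 2 <= Re (chart (iter k (horner F) z)) /\
      nm (chart (iter k (horner F) z) - (chart z + k%:R)) <= A * (1 + ln k.+1%:R).
Proof.
move=> /parabolic_near0[A [r [r0 r1 A0 Ar] h]].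
exists (2 * A); first lra.
have T1 : 1 <= r^-1 by rewrite invf_ge1.
exists (r^-1) => // z zT k.
suff : Re (chart z) + k%:R / 2 <= Re (chart (iter k (horner F) z)) /\
    nm (chart (iter k (horner F) z) - (chart z + k%:R)) <=
    2 * A * \sum_(i < k) (i.+1%:R : R)^-1.
  move=> [-> h1]; split=> //; apply: le_trans h1 _.
  by rewrite ler_wpM2l ?harmonic_le_ln//; lra.
elim: k => [|k [ih1 ih2]].
  by rewrite /= mul0r !addr0 subrr modulus0 big_ord0 mulr0.
rewrite iterS; set y := iter k _ z in ih1 ih2 *.
have k0 : (0 : R) <= k%:R by rewrite ler0n.
have cy : (k.+1%:R : R) / 2 <= nm (chart y).
  by apply: le_trans (modulus_ge_Re _); rewrite -(natr1 k) ger0_norm; lra.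
have cr : r^-1 <= nm (chart y).
  by apply: le_trans (modulus_ge_Re _); rewrite ger0_norm; lra.
have yr : 0 < nm y <= r.
  rewrite modulus_chart in cr.
  have i0 : 0 < (nm y)^-1 by lra.
  rewrite -invr_gt0 i0 /=; rewrite lef_pV2// in cr.
  by rewrite posrE -invr_gt0.
have [Fn hF] := h _ yr; case/andP: yr => y0 yr.
have yk : nm y <= 2 * (k.+1%:R)^-1.
  rewrite modulus_chart in cy.
  have -> : 2 * (k.+1%:R)^-1 = (k.+1%:R / 2)^-1 :> R by rewrite invf_div.
  by rewrite -[leLHS]invrK lef_pV2// posrE ?invr_gt0// divr_gt0// ltr0n.
split.
  have := modulus_ge_Re (chart F.[y] - (chart y + 1)).
  rewrite ler_norml => /andP[+ _]; rewrite !ReD ReN ReD.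
  have -> : Re 1 = 1 by [].
  have : A * nm y <= 1 / 2 by apply: le_trans Ar; rewrite ler_wpM2l.
  rewrite -(natr1 k); lra.
rewrite big_ord_recr /= mulrDr.
have -> : chart F.[y] - (chart z + k.+1%:R) =
  (chart y - (chart z + k%:R)) + (chart F.[y] - (chart y + 1)).
  by rewrite -(natr1 k); ring.
apply: le_trans (modulusD _ _) _; apply: lerD => //.
apply: le_trans hF _; rewrite -mulrA mulrCA ler_wpM2l//.
Qed.

(** An orbit tending to 0 without reaching it is eventually so close to 0 that each step
    adds at least 1/2 to the real part of the chart. *)
Lemma basin_orbit F : parabolic F -> forall z, basin F z -> forall M : R,
  exists k, M < Re (chart (iter k.+1 (horner F) z)).
Proof.
move=> /parabolic_near0[A [r [r0 r1 A0 Ar] h]] z [/cvg_modulusP/(_ _ r0)[k0 _ hk] zn] M.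
pose Z i := Re (chart (iter (k0.+1 + i) (horner F) z)).
have step i : Z 0%N + i%:R / 2 <= Z i.
  elim: i => [|i ih]; first by rewrite mul0r addr0.
  rewrite [leRHS]/Z addnS iterS; set y := iter (k0.+1 + i) _ z.
  have yr : nm y <= r.
    have /hk : (k0 <= k0.+1 + i)%N by rewrite addSn leqW// leq_addr.
    by rewrite subr0 => /ltW.
  have y0 : 0 < nm y by rewrite modulus_gt0; exact: zn.
  have [//|_ hF] := h y; first by rewrite y0.
  have := modulus_ge_Re (chart F.[y] - (chart y + 1)).
  rewrite ler_norml => /andP[+ _]; rewrite !ReD ReN ReD.
  have -> : Re 1 = 1 by [].
  have : A * nm y <= 1 / 2 by apply: le_trans Ar; rewrite ler_wpM2l.
  by move: ih; rewrite [leRHS]/Z -/y -(natr1 i); lra.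
pose i := (Num.trunc (2 * `|M - Z 0%N|)).+1.
exists (k0 + i)%N; rewrite -addSn; apply: lt_le_trans (step i).
have : 2 * `|M - Z 0%N| < i%:R by rewrite /i truncnS_gt// mulr_ge0.
by have := ler_norm (M - Z 0%N); lra.
Qed.

(** One iterate of the base point lies far in the right half-plane of the chart, hence so
    do those of its neighbours, and from there the asymptotics is uniform. *)
Lemma basin_asymptotics F : parabolic F -> forall z0, basin F z0 ->
  exists2 e : R, 0 < e & exists A : R, exists k1 : nat, 0 <= A /\
    forall z, nm (z - z0) < e -> forall k, (k1 < k)%N ->
      (k%:R - k1%:R) / 2 - 1 <= Re (chart (iter k (horner F) z)) /\
      nm (chart (iter k (horner F) z) - k%:R) <= A * (1 + ln k%:R).
Proof.
move=> hF z0 bz0; have [A A0 [T T1 h]] := parabolic_half_plane hF.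
have [k hk] := basin_orbit hF bz0 (T + 1).
have [L [M L0 hL]] := poly_iter_lipschitz F (nm z0 + 1) k.+1.
set y0 := iter k.+1 (horner F) z0 in hk *.
have c0 : nm (chart y0) > 1.
  by apply: lt_le_trans (modulus_ge_Re _); rewrite ger0_norm; lra.
have y00 : 0 < nm y0 by move: c0; rewrite modulus_chart -[nm y0]invrK invr_gt0 !invrK; lra.
(* 1/y is 2/|y0|^2-Lipschitz on the disc |y - y0| < |y0|/2 *)
pose d := Num.min (nm y0 / 2) (nm y0 ^+ 2 / 2).
have d0 : 0 < d by rewrite lt_min !divr_gt0// exprn_gt0.
have [dy dyy] : d <= nm y0 / 2 /\ d <= nm y0 ^+ 2 / 2.
  by split; rewrite ge_min lexx ?orbT.
exists (Num.min 1 (d / (L + 1))); first by rewrite lt_min ltr01 divr_gt0//; lra.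
exists (A + nm (chart y0) + 1 + k.+1%:R), k.+1.
have k10 : (0 : R) <= k.+1%:R by rewrite ler0n.
split; first lra.
move=> z; rewrite lt_min => /andP[zz1 zz2] m km.
have nz : nm z <= nm z0 + 1.
  by have := modulus_subr z z0; lra.
set y := iter k.+1 (horner F) z.
have yy0 : nm (y - y0) < d.
  have [_ +] := hL z z0 nz (ler_wpDr ler01 (lexx _)).
  move=> /le_lt_trans; apply; rewrite ltr_pdivlMr in zz2; last lra.
  by have := modulus_ge0 (z - z0); nra.
have cy : nm (chart y - chart y0) <= 1.
  have ny : nm y0 / 2 <= nm y.
    by have := modulus_subr y0 y; rewrite modulus_sym; lra.
  have yn : y != 0 by rewrite -modulus_gt0; lra.
  have y0n : y0 != 0 by rewrite -modulus_gt0.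
  rewrite /chart; have -> : - y^-1 - - y0^-1 = (y - y0) / (y * y0).
    by field; rewrite yn y0n.
  rewrite modulusM modulusV modulusM ler_pdivrMr ?mul1r; last by rewrite mulr_gt0//; lra.
  nra.
have RT : T <= Re (chart y).
  have := modulus_ge_Re (chart y - chart y0); rewrite ReD ReN ler_norml; lra.
have [j mE] : exists j, m = (j + k.+1)%N.
  by exists (m - k.+1)%N; rewrite subnK// ltnW.
have [] := h y RT j; rewrite -iterD -mE => h1 h2.
have mR : m%:R = j%:R + k.+1%:R :> R by rewrite mE natrD.
split; first by rewrite mR; lra.
have -> : chart (iter m (horner F) z) - m%:R =
  (chart (iter m (horner F) z) - (chart y + j%:R)) + (chart y - chart y0) +
  chart y0 - k.+1%:R.
  by rewrite mE natrD; ring.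
have m0 : (1 : R) <= m%:R by rewrite ler1n mE addnS.
have l0 : 0 <= ln m%:R :> R by rewrite ln_ge0.
have jm : ln j.+1%:R <= ln m%:R :> R.
  rewrite ler_ln ?posrE ?ltr0n//; last by rewrite mE addnS.
  by rewrite ler_nat mE addnS ltnS leq_addr.
apply: le_trans (modulusB _ _) _.
apply: le_trans (lerD (le_trans (modulusD _ _) (lerD (modulusD _ _) (lexx _))) (lexx _)) _.
have -> : nm (k.+1%:R) = k.+1%:R by rewrite -rC_nat modulus_rC normr_nat.
have := modulus_ge0 (chart y0).
nra.
Qed.

End ParabolicOrbits.

(** * One step through the gate *)

Section GateStep.
Variable R : realType.
Local Notation C := (Cplx R).
Local Notation nm := (@modulus R).

(** Writing m for the Moebius map z |-> (z + s) / (1 - z), the difference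
    m(z) - m(zt) is computed exactly, and the factor p^2 (1 - zt)^2 / (1 + s) turns it into
    e plus a quadratic term. What is left is f + c - m, which is of order three. *)
Lemma gate_step_identity (b k z zt s c e p : C) :
  p != 0 -> 1 - z != 0 -> 1 - zt != 0 -> 1 + s != 0 -> z = zt + e / p ^+ 2 ->
  let A := - b * zt ^+ 3 - s * zt + (c - s) in
  let B := - b * z ^+ 3 - s * z + (c - s) - (c - s) * z
           + z ^+ 4 * (k - (1 - b) - z * k) in
  let G := (1 - zt) ^+ 2 / ((1 + s) * (1 - z)) in
  p ^+ 2 * (1 - zt) ^+ 2 / (1 + s) *
    (z + z ^+ 2 + (1 - b) * z ^+ 3 + z ^+ 4 * k + c - (zt + s) / (1 - zt))
    - e - p ^+ 2 * A =
  e * (z - zt) / (1 - z) + p ^+ 2 * (G * (B - A) + (G - 1) * A).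
Proof.
move=> p0 z0 zt0 s0 zE A B G.
have eE : e = p ^+ 2 * (z - zt) by rewrite zE; field.
by rewrite eE /A /B /G; field; rewrite s0 z0 zt0.
Qed.

Lemma gate_factor_bound (u : R) (z zt s : C) : 0 < u -> u <= 1 / 4 ->
  nm zt <= u -> nm z <= 2 * u -> nm s <= u ^+ 2 ->
  let G := (1 - zt) ^+ 2 / ((1 + s) * (1 - z)) in
  nm (1 - z) >= 1 / 2 /\ nm (1 - zt) >= 1 / 2 /\ nm (1 + s) >= 1 / 2 /\
  nm G <= 7 /\ nm (G - 1) <= 20 * u.
Proof.
move=> u0 u4 hzt hz hs G.
have uu : u ^+ 2 <= u / 4 by rewrite expr2; nra.
have z1 : 1 / 2 <= nm (1 - z).
  by have := modulus_subr 1 z; rewrite modulus1; lra.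
have zt1 : 1 / 2 <= nm (1 - zt).
  by have := modulus_subr 1 zt; rewrite modulus1; lra.
have s1 : 1 / 2 <= nm (1 + s).
  by have := modulus_addr 1 s; rewrite modulus1; lra.
have sz : 1 / 4 <= nm ((1 + s) * (1 - z)) by rewrite modulusM; nra.
have sz0 : (1 + s) * (1 - z) != 0 by rewrite -modulus_gt0; lra.
have zt2 : nm (1 - zt) <= 5 / 4.
  by have := modulusB 1 zt; rewrite modulus1; lra.
split=> //; split=> //; split=> //; split.
  rewrite /G modulusM modulusV ler_pdivrMr; last lra.
  by rewrite modulusX; have := modulus_ge0 (1 - zt); nra.
have -> : G - 1 = (- (2 * zt) + zt ^+ 2 - s + z + s * z) / ((1 + s) * (1 - z)).
  by move: sz0; rewrite mulf_eq0 negb_or => /andP[h1 h2]; rewrite /G; field; rewrite ?h1 ?h2.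
rewrite modulusM modulusV ler_pdivrMr; last lra.
apply: (@le_trans _ _ (5 * u)); last nra.
apply: le_trans (modulusD _ _) _.
have := modulusD (- (2 * zt) + zt ^+ 2 - s) z.
have := modulusB (- (2 * zt) + zt ^+ 2) s.
have := modulusD (- (2 * zt)) (zt ^+ 2).
rewrite !(modulusX, modulusM, modulusN).
have -> : nm 2 = 2 by rewrite -(rC_nat R 2) modulus_rC normr_nat.
have := modulus_ge0 s; have := modulus_ge0 zt; have := modulus_ge0 z.
have h1 : nm s * nm z <= u ^+ 2 * (2 * u) by rewrite ler_pM ?modulus_ge0.
have h2 : nm zt ^+ 2 <= u ^+ 2 by rewrite ler_pXn2r ?nnegrE ?modulus_ge0// ltW.
nra.
Qed.

Lemma gate_drift_bound (u D Q v : R) (b q z zt s d : C) : 0 < u -> u <= 1 / 4 ->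
  0 <= D -> 0 <= Q -> nm zt <= u -> nm z <= 2 * u -> nm s <= u ^+ 2 ->
  nm d <= D * u ^+ 3 -> nm q <= Q -> nm (z - zt) <= v * u ^+ 2 -> 0 <= v ->
  let A := - b * zt ^+ 3 - s * zt + d in
  let B := - b * z ^+ 3 - s * z + d - d * z + z ^+ 4 * q in
  nm A <= (nm b + 1 + D) * u ^+ 3 /\
  nm (B - A) <= ((7 * nm b + 1) * v + 2 * D + 16 * Q) * u ^+ 4.
Proof.
move=> u0 u4 D0 Q0 hzt hz hs hd hq hv v0 A B.
have u0' := ltW u0.
have b0 := modulus_ge0 b; have zt0 := modulus_ge0 zt; have z0 := modulus_ge0 z.
have s0 := modulus_ge0 s; have d0 := modulus_ge0 d; have q0 := modulus_ge0 q.
have w0 := modulus_ge0 (z - zt).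
split.
  apply: le_trans (modulusD _ _) _.
  apply: le_trans (lerD (modulusB _ _) hd) _.
  rewrite !(modulusX, modulusM, modulusN).
  have h1 : nm b * nm zt ^+ 3 <= nm b * u ^+ 3.
    by rewrite ler_wpM2l// lerXn2r ?nnegrE.
  have h2 : nm s * nm zt <= u ^+ 2 * u by rewrite ler_pM.
  by rewrite -exprSr in h2; lra.
have -> : B - A = - b * ((z - zt) * (z ^+ 2 + z * zt + zt ^+ 2)) - s * (z - zt)
    - d * z + z ^+ 4 * q by rewrite /A /B; ring.
apply: le_trans (modulusD _ _) _.
apply: le_trans (lerD (le_trans (modulusB _ _) (lerD (modulusB _ _) (lexx _))) (lexx _)) _.
rewrite !(modulusX, modulusM, modulusN).
have h1 : nm (z ^+ 2 + z * zt + zt ^+ 2) <= 7 * u ^+ 2.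
  apply: le_trans (modulusD _ _) _; apply: le_trans (lerD (modulusD _ _) (lexx _)) _.
  rewrite !(modulusX, modulusM).
  have a1 : nm z ^+ 2 <= (2 * u) ^+ 2 by rewrite lerXn2r ?nnegrE//; lra.
  have a2 : nm zt ^+ 2 <= u ^+ 2 by rewrite lerXn2r ?nnegrE.
  have a3 : nm z * nm zt <= 2 * u * u by rewrite ler_pM.
  by rewrite exprMn in a1; rewrite -mulrA -expr2 in a3; lra.
have h2 : nm b * (nm (z - zt) * nm (z ^+ 2 + z * zt + zt ^+ 2)) <=
    nm b * (v * u ^+ 2 * (7 * u ^+ 2)).
  by rewrite ler_wpM2l// ler_pM// modulus_ge0.
have h3 : nm s * nm (z - zt) <= u ^+ 2 * (v * u ^+ 2) by rewrite ler_pM.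
have h4 : nm d * nm z <= D * u ^+ 3 * (2 * u) by rewrite ler_pM.
have h5 : nm z ^+ 4 * nm q <= (2 * u) ^+ 4 * Q.
  by rewrite ler_pM ?exprn_ge0// lerXn2r ?nnegrE//; lra.
apply: le_trans (lerD (lerD (lerD h2 h3) h4) h5) _.
by rewrite le_eqVlt; apply/orP; left; apply/eqP; ring.
Qed.

(** One step of the perturbed map z |-> f(z) + c seen from an orbit zt of
    z |-> (z + s) / (1 - z). The deviation e is measured in units of 1 / p^2, which is,
    up to a constant factor, the derivative of this orbit with respect to its initial point;
    in these units the Moebius map acts trivially to first order, and e drifts by an
    explicit cubic term.
    The bound 1/p stands for the size of the points and of sqrt s. *)
Lemma gate_step (f k : {poly C}) (b : C) (D : R) : 0 <= D ->
  (forall z, f.[z] = z + z ^+ 2 + (1 - b) * z ^+ 3 + z ^+ 4 * k.[z]) ->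
  exists2 A : R, 0 <= A & forall (p : R) (zt s c e : C), 4 <= p ->
    nm zt <= p^-1 -> nm s <= p^-1 ^+ 2 -> nm (c - s) <= D * p^-1 ^+ 3 ->
    nm e <= p / 2 ->
    nm ((rC p) ^+ 2 * (1 - zt) ^+ 2 / (1 + s) *
        (f.[zt + e / (rC p) ^+ 2] + c - (zt + s) / (1 - zt))
        - e - (rC p) ^+ 2 * (- b * zt ^+ 3 - s * zt + (c - s)))
    <= A * (1 + nm e ^+ 2) / p ^+ 2.
Proof.
move=> D0 fE.
have [Q Q0 hQ] := poly_bounded (k - (1 - b)%:P - 'X * k) 1.
have b0 := modulus_ge0 b.
exists (2 + 7 * (7 * nm b + 1) + 14 * D + 112 * Q + 20 * (nm b + 1 + D)); first lra.
move=> p zt s c e p4 hzt hs hc he.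
set u := p^-1 in hzt hs hc *.
have p0 : 0 < p by lra.
have u0 : 0 < u by rewrite invr_gt0.
have pu : p * u = 1 by rewrite mulfV ?gt_eqF.
have u4 : u <= 1 / 4 by nra.
set z := zt + _.
have pn : rC p != 0 by rewrite rC_eq0 gt_eqF.
have np : nm (rC p) = p by rewrite modulus_rC gtr0_norm.
have zv : nm (z - zt) = nm e * u ^+ 2.
  by rewrite /z addrC addKr modulusM modulusV modulusX np exprVn.
have e0 := modulus_ge0 e.
have zu : nm z <= 2 * u.
  have := modulusD zt (z - zt); rewrite subrKC zv.
  have : nm e * u ^+ 2 <= p / 2 * u ^+ 2 by rewrite ler_wpM2r// exprn_ge0// ltW.
  have -> : p / 2 * u ^+ 2 = (p * u) * u / 2 by ring.
  by rewrite pu; lra.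
have [z1 [zt1 [s1 [G7 G1]]]] := gate_factor_bound u0 u4 hzt zu hs.
have z10 : 1 - z != 0 by rewrite -modulus_gt0; lra.
have zt10 : 1 - zt != 0 by rewrite -modulus_gt0; lra.
have s10 : 1 + s != 0 by rewrite -modulus_gt0; lra.
have hq : nm (k.[z] - (1 - b) - z * k.[z]) <= Q.
  by have := hQ z; rewrite !hornerE; apply; lra.
have zv' : nm (z - zt) <= nm e * u ^+ 2 by rewrite zv.
have [hA hB] := gate_drift_bound b u0 u4 D0 Q0 hzt zu hs hc hq zv' e0.
rewrite fE (@gate_step_identity b k.[z] z)//.
move: hA hB G7 G1.
set A := _ - s * zt + _; set B := _ + _ ^+ 4 * _; set G := _ / _.
move=> hA hB G7 G1.
have pE : p ^- 2 = u ^+ 2 by rewrite exprVn.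
rewrite pE.
have h1 : nm (e * (z - zt) / (1 - z)) <= 2 * nm e ^+ 2 * u ^+ 2.
  rewrite modulusM modulusM modulusV zv ler_pdivrMr; last lra.
  have x0 : 0 <= nm e ^+ 2 * u ^+ 2 by rewrite mulr_ge0 ?exprn_ge0// ltW.
  have -> : nm e * (nm e * u ^+ 2) = nm e ^+ 2 * u ^+ 2 by ring.
  by rewrite -mulrA; nra.
have h2 : nm (G * (B - A) + (G - 1) * A) <=
    7 * (((7 * nm b + 1) * nm e + 2 * D + 16 * Q) * u ^+ 4) +
    20 * u * ((nm b + 1 + D) * u ^+ 3).
  apply: le_trans (modulusD _ _) _; rewrite (modulusM G) (modulusM (G - 1)).
  by apply: lerD; apply: ler_pM; rewrite ?modulus_ge0.
apply: le_trans (modulusD _ _) _; rewrite (modulusM (rC p ^+ 2)) modulusX np.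
apply: (@le_trans _ _ (2 * nm e ^+ 2 * u ^+ 2 + (7 * ((7 * nm b + 1) * nm e + 2 * D + 16 * Q)
    + 20 * (nm b + 1 + D)) * u ^+ 2)).
  apply: lerD => //; apply: (le_trans (ler_wpM2l _ h2)); first exact: exprn_ge0 (ltW p0).
  rewrite le_eqVlt; apply/orP; left; apply/eqP.
  transitivity ((p * u) ^+ 2 * (7 * ((7 * nm b + 1) * nm e + 2 * D + 16 * Q)
    + 20 * (nm b + 1 + D)) * u ^+ 2); last by rewrite pu expr1n mul1r.
  by ring.
rewrite -mulrDl; apply: ler_wpM2r; first by rewrite exprn_ge0// ltW.
have e1 : nm e <= 1 + nm e ^+ 2 by have := sqr_ge0 (nm e - 1); rewrite sqrrB1; nra.
have e2 := sqr_ge0 (nm e).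
have x1 : (7 * (7 * nm b + 1)) * nm e <= (7 * (7 * nm b + 1)) * (1 + nm e ^+ 2).
  by rewrite ler_wpM2l//; lra.
have x2 : 0 <= (14 * D + 112 * Q + 20 * (nm b + 1 + D)) * nm e ^+ 2.
  by rewrite mulr_ge0//; lra.
lra.
Qed.

End GateStep.

(** * The elliptic model *)

Section SineBounds.
Variable R : realType.
Implicit Types x : R.

Lemma ge0_derive_le (h dh : R -> R) x : 0 <= x ->
  (forall y : R, is_derive y 1 h (dh y)) -> (forall y, 0 <= y -> 0 <= dh y) ->
  h 0 <= h x.
Proof.
move=> x0 hd dh0.
have [|c] := @MVT_segment R h dh 0 x x0 (fun y _ => hd y).
  by apply: derivable_within_continuous => y _; case: (hd y).
rewrite in_itv /= => /andP[c0 _] /eqP.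
by rewrite subr0 subr_eq => /eqP ->; rewrite lerDr mulr_ge0// dh0.
Qed.

Lemma sin_le_id x : 0 <= x -> sin x <= x.
Proof.
move=> x0; rewrite -subr_ge0.
have := @ge0_derive_le (fun y => y - sin y) (fun y => 1 - cos y) x x0.
rewrite sin0 subr0; apply.
by move=> y _; rewrite subr_ge0 cos_le1.
Qed.

Lemma cos_ge_quad x : 0 <= x -> 1 - x ^+ 2 / 2 <= cos x.
Proof.
move=> x0.
have := @ge0_derive_le (fun y => cos y + 2^-1 * (y ^+ 2)) (fun y => - sin y + y) x x0.
rewrite cos0 expr0n /= mulr0 addr0 => h.
suff : 1 <= cos x + 2^-1 * x ^+ 2 by lra.
apply: h => [y|y y0]; last by rewrite addrC subr_ge0 sin_le_id.
apply: is_deriveD; apply: is_derive_eq.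
by rewrite /GRing.scale /=; field.
Qed.

Lemma sin_ge_cubic x : 0 <= x -> x - x ^+ 3 / 6 <= sin x.
Proof.
move=> x0.
have := @ge0_derive_le (fun y => sin y - y + 6^-1 * (y ^+ 3))
  (fun y => cos y - 1 + y ^+ 2 / 2) x x0.
rewrite sin0 expr0n /= mulr0 addr0 subr0 => h.
suff : 0 <= sin x - x + 6^-1 * x ^+ 3 by lra.
apply: h => [y|y y0]; last by have := cos_ge_quad y0; lra.
apply: is_deriveD; apply: is_derive_eq.
by rewrite /GRing.scale /=; field.
Qed.

Lemma tan_cubic x : 0 < x -> x <= 1 ->
  [/\ x - x ^+ 3 / 6 <= tan x & tan x <= x + x ^+ 3].
Proof.
move=> x0 x1; have c := cos_ge_quad (ltW x0); have s := sin_ge_cubic (ltW x0).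
have s1 := sin_le_id (ltW x0); have c1 := cos_le1 x.
have xx : x ^+ 2 <= 1 by rewrite expr_le1// ltW.
have c0 : 0 < cos x by lra.
have x3 : x ^+ 3 <= x by rewrite exprS ler_piMr// ltW.
rewrite /tan; split; first by rewrite ler_pdivlMr//; nra.
rewrite ler_pdivrMr//.
have -> : x + x ^+ 3 = x * (1 + x ^+ 2) by ring.
have h1 : 1 <= (1 + x ^+ 2) * cos x by nra.
by rewrite -mulrA; apply: le_trans s1 _; rewrite ler_peMr// ltW.
Qed.

End SineBounds.

Section EllipticOrbit.
Variable R : realType.

(** The map z |-> (z + s) / (1 - z) with s = (tan a)^2 is conjugate to the rotation
    x |-> x + a by z = - tan a * cot x. For a = pi / (2 n + 1) the orbit
    gate_orbit n j, with x = j a, starts from infinity at time 0 and is back there at time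
    2 n + 1; in between it comes in along the negative reals, close to - 1/j at first, and
    crosses the gate between the two fixed points + i tan a and - i tan a. Its
    derivative with respect to x is tan a / (sin x)^2, that is
    1 / (tan a * gate_width n j ^ 2). *)
Definition gate_angle (n : nat) : R := pi / (2 * n + 1)%:R.
Definition gate_tan (n : nat) : R := tan (gate_angle n).
Definition gate_width (n j : nat) : R := sin (j%:R * gate_angle n) / gate_tan n.
Definition gate_orbit (n j : nat) : R :=
  - cos (j%:R * gate_angle n) / gate_width n j.

Lemma pi_lt4 : (pi : R) < 4.
Proof. by have := @pihalf_lt2 R; lra. Qed.

Lemma odd_natr_gt0 n : 0 < (2 * n + 1)%:R :> R.
Proof. by rewrite addn1 ltr0n. Qed.

Lemma gate_angleM n : (2 * n + 1)%:R * gate_angle n = pi.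
Proof. by rewrite /gate_angle mulrCA mulfV ?mulr1// gt_eqF// odd_natr_gt0. Qed.

Lemma gate_angle_gt0 n : 0 < gate_angle n.
Proof. by rewrite divr_gt0 ?pi_gt0 ?odd_natr_gt0. Qed.

Lemma gate_angle_le1 n : (2 <= n)%N -> gate_angle n <= 1.
Proof.
move=> n2; rewrite ler_pdivrMr ?odd_natr_gt0// mul1r.
apply: (@le_trans _ _ 4); first exact: ltW pi_lt4.
by rewrite ler_nat; lia.
Qed.

(** The last bound says that the parameter s = (tan a)^2 is a^2 up to O(1/n^4),
    within the o(1/n^3) that the passage through the gate tolerates. *)
Lemma gate_tan_bounds n : (2 <= n)%N ->
  [/\ 0 < gate_tan n, 1 <= (2 * n + 1)%:R * gate_tan n,
      gate_angle n * (5 / 6) <= gate_tan n, gate_tan n <= 2 * gate_angle n &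
      `|gate_tan n ^+ 2 - gate_angle n ^+ 2| <= 3 * gate_angle n ^+ 4].
Proof.
move=> n2; have a1 := gate_angle_le1 n2; have a0 := gate_angle_gt0 n.
have [] := tan_cubic a0 a1; rewrite -/(gate_tan n).
have := gate_angleM n; set N := (2 * n + 1)%:R; set a := gate_angle n in a0 a1 *.
set t := gate_tan n => Na h1 h2.
have a2 : 0 <= a ^+ 2 <= 1 by rewrite sqr_ge0 expr_le1// ltW.
have a3 : 0 <= a ^+ 3 <= a.
  by rewrite exprS mulr_ge0 ?sqr_ge0 ?ler_piMr ?(ltW a0)//; case/andP: a2.
have a4 : 0 <= a ^+ 4 <= a ^+ 2.
  have -> : a ^+ 4 = a ^+ 2 * a ^+ 2 by ring.
  by case/andP: a2 => x y; rewrite mulr_ge0//= ler_piMr.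
case/andP: a2 => a20 a21; case/andP: a3 => a30 a31; case/andP: a4 => a40 a41.
have t0 : 0 < t by lra.
have N0 : 0 < N by exact: odd_natr_gt0.
split; [by []| |by lra|by lra|].
  have := @pi_ge2 R; rewrite -Na => h.
  by apply: (@le_trans _ _ (N * (a * (5 / 6)))); [lra|rewrite ler_wpM2l ?(ltW N0)//; lra].
have d : `|t - a| <= a ^+ 3 by rewrite ler_norml; lra.
have -> : t ^+ 2 - a ^+ 2 = (t - a) * (t + a) by ring.
rewrite normrM; have -> : 3 * a ^+ 4 = a ^+ 3 * (3 * a) by ring.
by apply: ler_pM => //; rewrite ger0_norm; lra.
Qed.

(** The entry and the exit of the gate are exchanged by x |-> pi - x; this is what makes
    the first-order effects of the two halves cancel. *)
Lemma gate_symmetry n j : (j <= 2 * n + 1)%N ->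
  gate_width n (2 * n + 1 - j) = gate_width n j /\
  gate_orbit n (2 * n + 1 - j) = - gate_orbit n j.
Proof.
move=> jN; have E : (2 * n + 1 - j)%:R * gate_angle n = pi - j%:R * gate_angle n.
  by rewrite natrB// mulrBl gate_angleM.
have w : gate_width n (2 * n + 1 - j) = gate_width n j.
  by rewrite /gate_width E sinB sinpi cospi mul0r sub0r mulN1r opprK.
split=> //; rewrite /gate_orbit w E cosB cospi sinpi mul0r addr0 mulN1r opprK.
by rewrite mulNr opprK.
Qed.

Lemma gate_width_gt0 n j : (2 <= n)%N -> (0 < j < 2 * n + 1)%N -> 0 < gate_width n j.
Proof.
move=> n2 /andP[j0 jN]; have [t0 _ _ _ _] := gate_tan_bounds n2.
rewrite divr_gt0// sin_gt0_pi// mulr_gt0 ?ltr0n ?gate_angle_gt0//=.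
by rewrite -(gate_angleM n) ltr_pM2r ?gate_angle_gt0// ltr_nat.
Qed.

Lemma gate_width_ge n j : (2 <= n)%N -> (j <= n)%N -> j%:R / 6 <= gate_width n j.
Proof.
move=> n2 jn; have [t0 _ _ t2 _] := gate_tan_bounds n2.
have a0 := gate_angle_gt0 n; set x := j%:R * gate_angle n.
have x0 : 0 <= x by rewrite mulr_ge0 ?ler0n// ltW.
have x2 : x <= 2.
  have : j%:R <= n%:R :> R by rewrite ler_nat.
  move/(ler_wpM2r (ltW a0)); rewrite -/x.
  have := gate_angleM n; rewrite natrD natrM; have := pi_lt4; lra.
rewrite ler_pdivlMr//; apply: le_trans (sin_ge_cubic x0).
have h : x ^+ 3 <= 4 * x by rewrite exprSr ler_wpM2r//; nra.
have : j%:R * gate_tan n <= j%:R * (2 * gate_angle n) by rewrite ler_wpM2l.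
by rewrite /x in h *; lra.
Qed.

Lemma gate_orbit_le n j : 0 < gate_width n j ->
  `|gate_orbit n j| <= (gate_width n j)^-1.
Proof.
move=> w0.
by rewrite /gate_orbit normrM normrN normfV (gtr0_norm w0) ler_piMl ?invr_ge0 ?(ltW w0) ?cos_max.
Qed.

Lemma gate_tan_width n j : (2 <= n)%N -> 0 < gate_width n j ->
  gate_tan n <= (gate_width n j)^-1 /\ gate_width n j <= (2 * n + 1)%:R.
Proof.
move=> n2 w0; have [t0 tN _ _ _] := gate_tan_bounds n2.
have h : gate_tan n * gate_width n j <= 1.
  by rewrite /gate_width mulrC mulfVK ?gt_eqF// sin_le1.
split; first by rewrite -[leRHS]mul1r ler_pdivlMr.
have := odd_natr_gt0 n; nra.
Qed.

(** The addition formulas for x = j a and a. *)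
Lemma gate_recurrence n j : (2 <= n)%N -> (0 < j)%N -> (j.+1 < 2 * n + 1)%N ->
  gate_width n j.+1 ^+ 2 =
    gate_width n j ^+ 2 * (1 - gate_orbit n j) ^+ 2 / (1 + gate_tan n ^+ 2) /\
  gate_orbit n j.+1 = (gate_orbit n j + gate_tan n ^+ 2) / (1 - gate_orbit n j).
Proof.
move=> n2 j0 jN; have [t0 _ _ _ _] := gate_tan_bounds n2.
have w0 : 0 < gate_width n j by apply: gate_width_gt0 => //; lia.
have w1 : 0 < gate_width n j.+1 by apply: gate_width_gt0.
have c0 : 0 < cos (gate_angle n).
  by apply: lt_le_trans (cos_ge_quad (ltW (gate_angle_gt0 n)));
    have := gate_angle_le1 n2; have := gate_angle_gt0 n; nra.
move: w0 w1; rewrite /gate_orbit /gate_width -(natr1 j) mulrDl mul1r.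
set x := j%:R * _; rewrite sinD cosD; set t := gate_tan n in t0 *.
have sE : sin (gate_angle n) = t * cos (gate_angle n).
  by rewrite /t /gate_tan /tan mulfVK// gt_eqF.
have tE : cos (gate_angle n) ^+ 2 * (1 + t ^+ 2) = 1.
  by rewrite mulrDr mulr1 -exprMn [_ * t]mulrC -sE cos2Dsin2.
move: c0 sE tE; set c := cos (gate_angle n) => c0 -> tE.
rewrite pmulr_lgt0 ?invr_gt0// pmulr_lgt0 ?invr_gt0// => s0 s1.
have tn : t != 0 by rewrite gt_eqF.
have sn : sin x != 0 by rewrite gt_eqF.
have cn : c != 0 by rewrite gt_eqF.
have t1 : 1 + t ^+ 2 != 0 by rewrite gt_eqF// ltr_pwDl// sqr_ge0.
have s1E : sin x * c + cos x * (t * c) = c * (sin x + cos x * t) by ring.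
have s2 : sin x + cos x * t != 0.
  by apply/negP => /eqP h; rewrite s1E h mulr0 ltxx in s1.
have c2 : c ^+ 2 = (1 + t ^+ 2)^-1 by rewrite -[LHS](mulfK t1) tE mul1r.
rewrite s1E; split.
  have -> : (c * (sin x + cos x * t) / t) ^+ 2 = c ^+ 2 * ((sin x + cos x * t) / t) ^+ 2.
    by rewrite -mulrA exprMn.
  by rewrite c2; field; rewrite tn sn t1.
by field; rewrite tn sn cn mulNr opprK s2.
Qed.

End EllipticOrbit.

(** * Crossing the gate *)

Section SlowSums.
Variable R : realType.

(** The errors of the gate are O((log d)^2 / d^2) = O(d^(-3/2)) at distance d from its
    ends; this bound makes their sum telescope. *)
Lemma telescope_sqrt (m : nat) : (2 <= m)%N ->
  (m%:R * Num.sqrt m%:R)^-1 <=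
    2 * ((Num.sqrt m.-1%:R)^-1 - (Num.sqrt m%:R)^-1) :> R.
Proof.
case: m => [//|m] m1 /=.
have m0 : 0 < m%:R :> R by rewrite ltr0n.
have sE : Num.sqrt m.+1%:R ^+ 2 = m%:R + 1 :> R by rewrite sqr_sqrtr ?natr1.
have tE : Num.sqrt m%:R ^+ 2 = m%:R :> R by rewrite sqr_sqrtr.
have t0 : 0 < Num.sqrt m%:R :> R by rewrite sqrtr_gt0.
have s0 : 0 < Num.sqrt m.+1%:R :> R by rewrite sqrtr_gt0.
have sE' : m.+1%:R = Num.sqrt m.+1%:R ^+ 2 :> R by rewrite sE natr1.
rewrite {1}sE'; move: s0 t0 sE tE.
set s := Num.sqrt m.+1%:R; set t := Num.sqrt m%:R => s0 t0 sE tE.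
have st : (s - t) * (s + t) = 1 by rewrite -subr_sqr sE tE addrC addKr.
have ts : t <= s by nra.
have -> : 2 * (t^-1 - s^-1) = 2 * (s - t) / (s * t).
  by field; rewrite !gt_eqF.
have s3 : 0 < s ^+ 2 * s by rewrite mulr_gt0 ?exprn_gt0.
rewrite ler_pdivlMr ?mulr_gt0// mulrC ler_pdivrMr//.
have : 1 <= 2 * s * (s - t) by nra.
have : 0 < s * s by rewrite mulr_gt0.
nra.
Qed.

Lemma ln_sqr_le_sqrt (d : nat) : (0 < d)%N ->
  (1 + ln d.+1%:R) ^+ 2 <= 50 * Num.sqrt d%:R :> R.
Proof.
move=> d0; have D0 : 1 <= d%:R :> R by rewrite ler1n.
set q : R := Num.sqrt (Num.sqrt d.+1%:R).
have q2 : q ^+ 2 = Num.sqrt d.+1%:R by rewrite sqr_sqrtr ?sqrtr_ge0.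
have q4 : q ^+ 4 = d.+1%:R.
  by rewrite (exprM q 2 2) q2 sqr_sqrtr.
have q0 : 0 < q by rewrite !sqrtr_gt0.
have q1 : 1 <= q by rewrite -(ler_pXn2r (n := 4)) ?nnegrE ?(ltW q0)// q4 expr1n ler1n.
have l0 : 0 <= ln d.+1%:R :> R by rewrite ln_ge0// ler1n.
have l4 : ln d.+1%:R <= 4 * q.
  have -> : ln d.+1%:R = 4 * ln q by rewrite -q4 lnXn// mulr_natl.
  by rewrite ler_wpM2l// ltW// ln_sublinear.
have s2 : Num.sqrt d.+1%:R <= 2 * Num.sqrt d%:R :> R.
  have -> : 2 * Num.sqrt d%:R = Num.sqrt (4 * d%:R) :> R.
    by rewrite sqrtrM// (_ : 4 = 2 ^+ 2) ?sqrtr_sqr ?ger0_norm//; ring.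
  by rewrite ler_wsqrtr// -natr1; lra.
have : (1 + ln d.+1%:R) ^+ 2 <= (5 * q) ^+ 2 by rewrite ler_pXn2r ?nnegrE//; lra.
rewrite exprMn q2; lra.
Qed.

Lemma antisymmetric_sum (V : numFieldType) (F : nat -> V) (m n : nat) :
  (forall i, (m <= i < n)%N -> F (m + n - i.+1)%N = - F i) ->
  \sum_(m <= i < n) F i = 0.
Proof.
move=> hF; set S := (X in X = 0).
have : S = - S by rewrite {1}/S big_nat_rev /= -sumrN; apply: eq_big_nat => i /hF.
by move/eqP; rewrite -addr_eq0 -mulr2n -mulr_natl mulf_eq0 pnatr_eq0 => /eqP.
Qed.

End SlowSums.

Section GatePassage.
Variable R : realType.
Local Notation C := (Cplx R).
Local Notation nm := (@modulus R).
Implicit Types (b : C) (ka th : R) (n j : nat).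

(** In the unit 1 / gate_width n j ^ 2 the Moebius map itself leaves the deviation
    unchanged to first order. *)
Definition gate_dev n (z : C) j : C :=
  rC (gate_width R n j) ^+ 2 * (z - rC (gate_orbit R n j)).

(** First-order variation of the deviation during step j: the first two terms are
    the difference at order three between f + s and the Moebius map, 1 - b being the cubic
    coefficient of f, and the last one is the slow decrease of the forcing about its value
    at mid-time, with slope - 2 ka. *)
Definition gate_drift b ka n j : C :=
  rC (gate_width R n j) ^+ 2 *
    (- b * rC (gate_orbit R n j) ^+ 3 - rC (gate_tan R n ^+ 2) * rC (gate_orbit R n j)
     + rC (ka * ((2 * n + 1)%:R - 2 * j%:R))).

Lemma gate_drift_antisym b ka n j : (j <= 2 * n + 1)%N ->
  gate_drift b ka n (2 * n + 1 - j) = - gate_drift b ka n j.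
Proof.
move=> jN; rewrite /gate_drift; have [-> ->] := gate_symmetry R jN.
have -> : ka * ((2 * n + 1)%:R - 2 * (2 * n + 1 - j)%:R) =
  - (ka * ((2 * n + 1)%:R - 2 * j%:R)) by rewrite natrB//; ring.
by rewrite !rCN; ring.
Qed.

Lemma gate_parabolic_bound ka M n j : (2 <= n)%N -> (0 < j < 2 * n + 1)%N -> 0 <= ka ->
  ka * (2 * n + 1)%:R ^+ 4 <= M ->
  `|ka * ((2 * n + 1)%:R - 2 * j%:R)| <= M * (gate_width R n j)^-1 ^+ 3.
Proof.
move=> n2 jN ka0 kaM; have w0 := gate_width_gt0 R n2 jN.
have [_ wN] := gate_tan_width n2 w0.
set N : R := (2 * n + 1)%:R in kaM wN *; set w := gate_width R n j in w0 wN *.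
have N0 : 0 < N by rewrite odd_natr_gt0.
have M0 : 0 <= M by apply: le_trans kaM; rewrite mulr_ge0// exprn_ge0// ltW.
apply: (@le_trans _ _ (ka * N)).
  rewrite normrM ger0_norm// ler_wpM2l// ler_norml.
  have jN' : j%:R <= N by rewrite ler_nat; lia.
  by have : 0 <= j%:R :> R by []; lra.
apply: (@le_trans _ _ (M * N^-1 ^+ 3)).
  rewrite exprVn ler_pdivlMr ?exprn_gt0//.
  by have -> : ka * N * N ^+ 3 = ka * N ^+ 4 by ring.
apply: ler_wpM2l => //; rewrite lerXn2r ?nnegrE ?invr_ge0 ?(ltW w0) ?(ltW N0)//.
by rewrite lef_pV2.
Qed.

Lemma gate_drift_le b ka M n j : (2 <= n)%N -> (0 < j < 2 * n + 1)%N -> 0 <= ka ->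
  ka * (2 * n + 1)%:R ^+ 4 <= M ->
  nm (gate_drift b ka n j) <= (nm b + 1 + M) / gate_width R n j.
Proof.
move=> n2 jN ka0 kaM; have w0 := gate_width_gt0 R n2 jN.
have hk := gate_parabolic_bound n2 jN ka0 kaM.
have [tw _] := gate_tan_width n2 w0; have [t0 _ _ _ _] := gate_tan_bounds R n2.
have zw := gate_orbit_le w0.
rewrite /gate_drift; move: hk tw t0 zw w0.
set w := gate_width R n j; set t := gate_tan R n; set z := gate_orbit R n j.
set d := ka * _ => hk tw t0 zw w0.
rewrite modulusM modulusX modulus_rC gtr0_norm//; set u := w^-1 in hk tw zw *.
have wu : w * u = 1 by rewrite mulfV ?gt_eqF.
have u0 : 0 < u by rewrite invr_gt0.
have h : nm (- b * rC z ^+ 3 - rC (t ^+ 2) * rC z + rC d) <= (nm b + 1 + M) * u ^+ 3.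
  apply: le_trans (modulusD _ _) _; rewrite modulus_rC.
  apply: le_trans (lerD (modulusB _ _) hk) _.
  rewrite !(modulusX, modulusM, modulusN, modulus_rC) !normrX (gtr0_norm t0).
  have h1 : nm b * `|z| ^+ 3 <= nm b * u ^+ 3.
    by rewrite ler_wpM2l ?modulus_ge0// lerXn2r ?nnegrE// ltW.
  have h2 : t ^+ 2 * `|z| <= u ^+ 2 * u.
    by rewrite ler_pM ?exprn_ge0 ?(ltW t0)// lerXn2r ?nnegrE// ltW.
  by rewrite -exprSr in h2; lra.
apply: le_trans (ler_wpM2l _ h) _; first by rewrite exprn_ge0// ltW.
have -> : w ^+ 2 * ((nm b + 1 + M) * u ^+ 3) = (nm b + 1 + M) * u * (w * u) ^+ 2 by ring.
by rewrite wu expr1n mulr1.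
Qed.

Lemma gate_dev_step (f k : {poly C}) b (M : R) :
  (forall z, f.[z] = z + z ^+ 2 + (1 - b) * z ^+ 3 + z ^+ 4 * k.[z]) -> 0 <= M ->
  exists2 A : R, 0 <= A & forall n ka th j (z c : C), (2 <= n)%N ->
    (0 < j)%N -> (j.+1 < 2 * n + 1)%N -> 0 <= ka -> ka * (2 * n + 1)%:R ^+ 4 <= M ->
    th * (2 * n + 1)%:R ^+ 3 <= 1 ->
    nm (c - rC (gate_tan R n ^+ 2) - rC (ka * ((2 * n + 1)%:R - 2 * j%:R))) <= th ->
    4 <= gate_width R n j -> nm (gate_dev n z j) <= gate_width R n j / 2 ->
    nm (gate_dev n (f.[z] + c) j.+1 - gate_dev n z j - gate_drift b ka n j) <=
      A * (1 + nm (gate_dev n z j) ^+ 2) / gate_width R n j ^+ 2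
      + (2 * n + 1)%:R ^+ 2 * th.
Proof.
move=> fE M0; have M1 : 0 <= M + 1 by lra.
have [A A0 hA] := gate_step M1 fE.
exists A => // n ka th j z c n2 j0 jN ka0 kaM thN hc w4 he.
have jN' : (0 < j < 2 * n + 1)%N by lia.
have w0 := gate_width_gt0 R n2 jN'.
have hk := gate_parabolic_bound n2 jN' ka0 kaM.
have [tw wN] := gate_tan_width n2 w0; have [t0 _ _ _ _] := gate_tan_bounds R n2.
have zw := gate_orbit_le w0.
have [wS oS] := gate_recurrence R n2 j0 jN.
move: hk tw t0 zw w0 wS oS hc w4 he wN; rewrite /gate_dev /gate_drift.
set w := gate_width R n j; set t := gate_tan R n; set zt := gate_orbit R n j.
set d := ka * _; set N : R := (2 * n + 1)%:R => hk tw t0 zw w0 wS oS hc w4.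
set e := rC w ^+ 2 * _ => he wN.
have wn : rC w != 0 by rewrite rC_eq0 gt_eqF.
have N0 : 0 < N by rewrite odd_natr_gt0.
have th0 : 0 <= th by apply: le_trans hc; exact: modulus_ge0.
have zE : z = rC zt + e / rC w ^+ 2.
  by rewrite /e mulrAC mulfV ?expf_neq0// mul1r subrKC.
have thw : th <= w^-1 ^+ 3.
  rewrite exprVn -[leRHS]mul1r ler_pdivlMr ?exprn_gt0//; apply: le_trans thN.
  by rewrite ler_wpM2l// lerXn2r ?nnegrE ?(ltW w0) ?(ltW N0).
have hcs : nm (c - rC (t ^+ 2)) <= (M + 1) * w^-1 ^+ 3.
  have := modulusD (c - rC (t ^+ 2) - rC d) (rC d); rewrite subrK modulus_rC.
  by lra.
have hs : nm (rC (t ^+ 2)) <= w^-1 ^+ 2.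
  by rewrite modulus_rC normrX lerXn2r ?nnegrE ?invr_ge0 ?(ltW w0)// gtr0_norm.
have := hA w (rC zt) (rC (t ^+ 2)) c e w4 _ hs hcs he.
rewrite modulus_rC => /(_ zw); rewrite -zE => main.
have -> : rC (gate_width R n j.+1) ^+ 2 * (f.[z] + c - rC (gate_orbit R n j.+1)) =
  rC w ^+ 2 * (1 - rC zt) ^+ 2 / (1 + rC (t ^+ 2)) *
  (f.[z] + c - (rC zt + rC (t ^+ 2)) / (1 - rC zt)).
  by rewrite -rCX wS oS !(rCX, rCV, rCB, rCD, rCM, rC1).
set X := _ / _ * _ in main *.
have -> : X - e - rC w ^+ 2 *
    (- b * rC zt ^+ 3 - rC (t ^+ 2) * rC zt + rC d) =
  (X - e - rC w ^+ 2 * (- b * rC zt ^+ 3 - rC (t ^+ 2) * rC zt +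
   (c - rC (t ^+ 2)))) + rC w ^+ 2 * (c - rC (t ^+ 2) - rC d) by ring.
apply: le_trans (modulusD _ _) _; apply: lerD => //.
rewrite modulusM modulusX modulus_rC gtr0_norm//.
by apply: ler_pM; rewrite ?exprn_ge0 ?modulus_ge0 ?(ltW w0)// lerXn2r ?nnegrE ?(ltW w0) ?(ltW N0).
Qed.

Lemma gate_width_ge_min n j : (2 <= n)%N -> (j <= 2 * n + 1)%N ->
  (minn j (2 * n + 1 - j))%:R / 6 <= gate_width R n j.
Proof.
move=> n2 jN; have [jn|nj] := leqP j n.
  apply: le_trans (gate_width_ge R n2 jn).
  by rewrite ler_pM2r// ler_nat geq_minl.
have [<- _] := gate_symmetry R jN.
have jn : (2 * n + 1 - j <= n)%N by lia.
apply: le_trans (gate_width_ge R n2 jn).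
by rewrite ler_pM2r// ler_nat geq_minr.
Qed.

(** The drift is O(1/d) at distance d from the ends and odd about the middle of the
    passage, so that its partial sums are O(log d): those which go past the middle
    cancel down to the sum over a shorter initial interval. *)
Lemma gate_drift_sum b ka M n K j : (2 <= n)%N -> (0 < K)%N -> 0 <= ka ->
  ka * (2 * n + 1)%:R ^+ 4 <= M -> 0 <= M -> (K <= j)%N -> (j <= 2 * n + 1 - K)%N ->
  nm (\sum_(K <= i < j) gate_drift b ka n i) <=
    6 * (nm b + 1 + M) * (1 + ln (minn j (2 * n + 1 - j)).+1%:R).
Proof.
move=> n2 K0 ka0 kaM M0 Kj jK; set E := nm b + 1 + M.
have E0 : 0 <= E by have := modulus_ge0 b; rewrite /E; lra.
have first_half m : (K <= m)%N -> (m <= n.+1)%N ->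
    nm (\sum_(K <= i < m) gate_drift b ka n i) <=
    6 * E * (1 + ln m%:R).
  move=> Km mn; suff h : nm (\sum_(K <= i < m) gate_drift b ka n i) <=
      6 * E * \sum_(i < m.-1) (i.+1%:R)^-1.
    apply: le_trans h _; rewrite ler_wpM2l ?mulr_ge0//.
    apply: le_trans (harmonic_le_ln R m.-1) _.
    by rewrite prednK//; lia.
  elim: m Km mn => [|m ih] Km mn; first by lia.
  have [Km'|Km'] := leqP K m; last first.
    have -> : K = m.+1 by lia.
    rewrite big_geq// modulus0; apply: mulr_ge0; first by rewrite mulr_ge0.
    by apply: sumr_ge0 => i _; rewrite invr_ge0.
  rewrite big_nat_recr//=; apply: le_trans (modulusD _ _) _.
  have m0 : (0 < m)%N by lia.
  have -> : \sum_(i < m) (i.+1%:R : R)^-1 = \sum_(i < m.-1) (i.+1%:R)^-1 + (m%:R)^-1.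
    by case: (m) m0 => // m' _; rewrite big_ord_recr.
  rewrite mulrDr; apply: lerD; first by apply: ih; lia.
  have hm : (0 < m < 2 * n + 1)%N by lia.
  apply: le_trans (gate_drift_le b n2 hm ka0 kaM) _; rewrite -/E.
  have mR : 0 < m%:R :> R by rewrite ltr0n.
  have wm : m%:R / 6 <= gate_width R n m by apply: gate_width_ge => //; lia.
  have w0 := gate_width_gt0 R n2 hm.
  rewrite ler_pdivrMr// mulrAC ler_pdivlMr//.
  have -> : 6 * E * gate_width R n m = E * (6 * gate_width R n m) by ring.
  by apply: ler_wpM2l => //; lra.
have ln_mono p q : (0 < p)%N -> (p <= q)%N ->
    6 * E * (1 + ln p%:R) <= 6 * E * (1 + ln q%:R).
  move=> p0 pq; rewrite ler_wpM2l ?mulr_ge0// lerD2l ler_ln ?posrE ?ltr0n//.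
    by rewrite ler_nat.
  exact: leq_trans pq.
have [jn|nj] := leqP j n.+1.
  apply: le_trans (first_half j Kj jn) _; apply: ln_mono; first by lia.
  by rewrite -addn1 addn_minl leq_min; lia.
have mid : (2 * n + 1 - j).+1 = (2 * n + 1 + 1 - j)%N by lia.
rewrite (@big_cat_nat _ _ _ (2 * n + 1 - j).+1)/=; [|lia|lia].
rewrite [X in _ + X]antisymmetric_sum ?addr0; last first.
  move=> i hi; rewrite -gate_drift_antisym; last by lia.
  by congr (gate_drift _ _ _ _); lia.
apply: le_trans (first_half _ _ _) _; [lia|lia|].
by apply: ln_mono; [lia|rewrite ltnS leq_min; lia].
Qed.

Lemma log_growth_sqr (C3 h l e s : R) : 0 <= C3 -> 0 <= h -> 0 <= e -> 1 <= s ->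
  h <= C3 * (1 + l) -> (1 + l) ^+ 2 <= 50 * s -> e <= h + 1 ->
  1 + e ^+ 2 <= (100 * C3 ^+ 2 + 3) * s.
Proof.
move=> C30 h0 e0 s1 hl ls eh.
have h2 : h ^+ 2 <= C3 ^+ 2 * (50 * s).
  apply: (@le_trans _ _ ((C3 * (1 + l)) ^+ 2)).
    by rewrite lerXn2r ?nnegrE//; apply: le_trans hl.
  by rewrite exprMn ler_wpM2l ?sqr_ge0.
have e2 : e ^+ 2 <= (h + 1) ^+ 2 by rewrite lerXn2r ?nnegrE//; lra.
have := sqr_ge0 (h - 1); lra.
Qed.

Lemma small_deviation (C4 d w e : R) : 0 <= e -> 1 <= d -> 0 <= C4 -> 144 * C4 <= d ->
  d / 6 <= w -> 1 + e ^+ 2 <= C4 * Num.sqrt d -> e <= w / 2.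
Proof.
move=> e0 d1 C40 C4d dw he.
have sd : Num.sqrt d <= d.
  have d0 : 0 <= d by lra.
  by rewrite -{2}(sqr_sqrtr d0) expr2 ler_peMl ?sqrtr_ge0// -[leLHS]sqrtr1 ler_wsqrtr.
rewrite -(ler_pXn2r (n := 2)) ?nnegrE//; last lra.
apply: (@le_trans _ _ ((d / 12) ^+ 2)); last by rewrite lerXn2r ?nnegrE//; lra.
have h1 : C4 * Num.sqrt d <= C4 * d by rewrite ler_wpM2l.
have h2 : 144 * C4 * d <= d * d by rewrite ler_wpM2r//; lra.
rewrite exprMn exprVn; lra.
Qed.

Lemma step_error_le (A C4 d w e : R) : 0 <= A -> 0 < d -> d / 6 <= w ->
  1 + e ^+ 2 <= C4 * Num.sqrt d ->
  A * (1 + e ^+ 2) / w ^+ 2 <= 36 * A * C4 * (d * Num.sqrt d)^-1.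
Proof.
move=> A0 d0 dw he.
have w0 : 0 < w by lra.
have d6 : 0 < d / 6 by lra.
apply: (@le_trans _ _ (A * (C4 * Num.sqrt d) / (d / 6) ^+ 2)).
  apply: ler_pM; rewrite ?invr_ge0 ?exprn_ge0 ?(ltW w0)//.
  - by rewrite mulr_ge0// addr_ge0// sqr_ge0.
  - by rewrite ler_wpM2l.
  - by rewrite lef_pV2 ?posrE ?exprn_gt0// lerXn2r ?nnegrE// ltW.
have sd2 : Num.sqrt d ^+ 2 = d by rewrite sqr_sqrtr// ltW.
have sd0 : 0 < Num.sqrt d by rewrite sqrtr_gt0.
move: sd0 sd2; set s := Num.sqrt _ => sd0 <-.
rewrite le_eqVlt; apply/orP; left; apply/eqP.
by field; rewrite gt_eqF.
Qed.

(** All the terms cancel in pairs, except the one of index K. *)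
Lemma gate_drift_total b ka M n K : (2 <= n)%N -> (0 < K)%N -> (K < n)%N -> 0 <= ka ->
  ka * (2 * n + 1)%:R ^+ 4 <= M -> 0 <= M ->
  nm (\sum_(K <= i < 2 * n + 1 - K) gate_drift b ka n i) <=
    6 * (nm b + 1 + M) / Num.sqrt K%:R.
Proof.
move=> n2 K0 Kn ka0 kaM M0.
have E0 : 0 <= nm b + 1 + M by have := modulus_ge0 b; lra.
rewrite (@big_cat_nat _ _ _ K.+1)//=; last by lia.
rewrite big_nat1 antisymmetric_sum ?addr0; last first.
  move=> i hi; rewrite -gate_drift_antisym; last by lia.
  by congr (gate_drift _ _ _ _); lia.
have hK : (0 < K < 2 * n + 1)%N by lia.
apply: le_trans (gate_drift_le b n2 hK ka0 kaM) _.
have KR0 : 0 < K%:R :> R by rewrite ltr0n.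
have wK : K%:R / 6 <= gate_width R n K by apply: gate_width_ge => //; lia.
have sKK : Num.sqrt K%:R <= K%:R :> R.
  rewrite -{2}(sqr_sqrtr (ltW KR0)) expr2 ler_peMl ?sqrtr_ge0//.
  by rewrite -[leLHS]sqrtr1 ler_wsqrtr// ler1n.
have sK0 : 0 < Num.sqrt K%:R :> R by rewrite sqrtr_gt0.
have -> : 6 * (nm b + 1 + M) / Num.sqrt K%:R = (nm b + 1 + M) * (Num.sqrt K%:R / 6)^-1.
  by rewrite invf_div; ring.
have w0 := gate_width_gt0 R n2 hK; have s6 : 0 < Num.sqrt K%:R / 6 :> R by rewrite divr_gt0.
apply: ler_wpM2l => //; rewrite lef_pV2 ?posrE//.
by apply: le_trans wK; rewrite ler_pM2r.
Qed.

(** Crossing the gate from step K to step 2 n + 1 - K moves the deviation by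
    O(1 / sqrt K) only, uniformly in n. Half-way the deviation may be as large as log n,
    but it follows the partial sums of the drift, which cancel in the end, up to errors
    O((log d)^2 / d^2) whose sum over the passage is O(1 / sqrt K). *)
Lemma gate_passage (f k : {poly C}) b (M B : R) :
  (forall z, f.[z] = z + z ^+ 2 + (1 - b) * z ^+ 3 + z ^+ 4 * k.[z]) -> 0 <= M ->
  exists2 A : R, 0 <= A & exists K2 : nat, forall K n ka th (z c : nat -> C),
    (K2 <= K)%N -> (K.+1 < n)%N -> 0 <= ka -> ka * (2 * n + 1)%:R ^+ 4 <= M ->
    th * (2 * n + 1)%:R ^+ 3 * Num.sqrt K%:R <= 1 ->
    (forall j, (K <= j)%N -> (j < 2 * n + 1 - K)%N ->
      z j.+1 = f.[z j] + c j /\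
      nm (c j - rC (gate_tan R n ^+ 2) - rC (ka * ((2 * n + 1)%:R - 2 * j%:R))) <= th) ->
    nm (gate_dev n (z K) K - b * rC (ln K%:R)) <= B ->
    nm (gate_dev n (z (2 * n + 1 - K)%N) (2 * n + 1 - K) - gate_dev n (z K) K)
      <= A / Num.sqrt K%:R.
Proof.
move=> fE M0; have [A A0 hA] := gate_dev_step fE M0.
have b0 := modulus_ge0 b.
(* C3 (1 + log d) bounds the expected deviation H, C4 sqrt d the actual one squared *)
pose C3 := `|B| + nm b + 6 * (nm b + 1 + M).
have C30 : 0 <= C3 by rewrite /C3; have := normr_ge0 B; order_lra.
pose C4 := 100 * C3 ^+ 2 + 3.
have C40 : 3 <= C4 by rewrite /C4; have := sqr_ge0 C3; order_lra.
pose C5 := 36 * A * C4.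
have C50 : 0 <= C5 by rewrite /C5 !mulr_ge0//; order_lra.
exists (2 * (4 * C5 + 1) + 6 * (nm b + 1 + M)); first order_lra.
pose K2 := (Num.trunc (144 * C4 + 4 * (4 * C5 + 1) ^+ 2)).+1.
exists K2 => K n ka th z c K2K Kn ka0 kaM thN hz hB.
have KR : 144 * C4 + 4 * (4 * C5 + 1) ^+ 2 < K%:R.
  have h1 : (K2%:R : R) <= K%:R by rewrite ler_nat.
  by apply: lt_le_trans h1; rewrite /K2 truncnS_gt//; have := sqr_ge0 (4 * C5 + 1); order_lra.
have q0 := sqr_ge0 (4 * C5 + 1).
have K2n : (2 <= K)%N by rewrite -(ler_nat R); order_lra.
have n2 : (2 <= n)%N by nat_lia.
set N := (2 * n + 1)%N in kaM thN hz *.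
have N0 : 0 < N%:R :> R by rewrite odd_natr_gt0.
have sK0 : 0 < Num.sqrt K%:R :> R by rewrite sqrtr_gt0 ltr0n; nat_lia.
have sK1 : 1 <= Num.sqrt K%:R :> R.
  by rewrite -[leLHS]sqrtr1 ler_wsqrtr// ler1n; nat_lia.
have th0 : 0 <= th by apply: le_trans (hz K _ _).2; [exact: modulus_ge0|nat_lia|nat_lia].
have thN1 : th * N%:R ^+ 3 <= 1.
  by apply: le_trans thN; rewrite ler_peMr// mulr_ge0// exprn_ge0// ltW.
(* e j - H j is what the drift does not explain; P majorises it *)
pose isq (m : nat) : R := (Num.sqrt m%:R)^-1.
have isq_ge0 m : 0 <= isq m by rewrite invr_ge0 sqrtr_ge0.
have isq_anti m m' : (0 < m)%N -> (m <= m')%N -> isq m' <= isq m.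
  move=> m0 mm; rewrite lef_pV2 ?posrE ?sqrtr_gt0 ?ltr0n//; last exact: leq_trans mm.
  by rewrite ler_wsqrtr// ler_nat.
pose e j := gate_dev n (z j) j.
pose H j := e K + \sum_(K <= i < j) gate_drift b ka n i.
pose P j := 2 * C5 * ((isq K.-1 - isq j.-1) + (isq (N - j)%N - isq (N - K)%N))
  + (j%:R - K%:R) * (N%:R ^+ 2 * th).
have P1 j : (K <= j)%N -> (j <= N - K)%N -> P j <= (4 * C5 + 1) * isq K.-1.
  move=> Kj jK; rewrite /P.
  have i1 : isq (N - j)%N <= isq K.-1 by apply: isq_anti; nat_lia.
  have i2 := isq_ge0 j.-1; have i3 := isq_ge0 (N - K)%N.
  have i4 : (j%:R - K%:R) * (N%:R ^+ 2 * th) <= isq K.-1.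
    apply: (@le_trans _ _ (N%:R * (N%:R ^+ 2 * th))).
      apply: ler_wpM2r; first by rewrite mulr_ge0// exprn_ge0// ltW.
      have : j%:R <= N%:R :> R by rewrite ler_nat; nat_lia.
      have : 0 <= K%:R :> R by [].
      order_lra.
    have -> : N%:R * (N%:R ^+ 2 * th) = th * N%:R ^+ 3 by ring.
    apply: (@le_trans _ _ (isq K)); last by apply: isq_anti; nat_lia.
    by rewrite /isq -[leRHS]mul1r ler_pdivlMr.
  have i5 : 2 * C5 * ((isq K.-1 - isq j.-1) + (isq (N - j)%N - isq (N - K)%N)) <=
    2 * C5 * (2 * isq K.-1) by apply: ler_wpM2l; order_lra.
  order_lra.
have isqK : isq K.-1 <= 2 * isq K.
  have -> : 2 * isq K = (Num.sqrt (K%:R / 4))^-1.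
    rewrite sqrtrM// sqrtrV// (_ : 4 = 2 ^+ 2); last by ring.
    by rewrite sqrtr_sqr ger0_norm// invfM invrK mulrC.
  rewrite lef_pV2 ?posrE ?sqrtr_gt0 ?divr_gt0 ?ltr0n//; [|nat_lia|nat_lia].
  apply: ler_wsqrtr; have : 2 <= K%:R :> R by rewrite ler_nat.
  have : K%:R = K.-1%:R + 1 :> R by rewrite natr1 prednK//; nat_lia.
  order_lra.
have isqK1 : (4 * C5 + 1) * (2 * isq K) <= 1.
  rewrite /isq mulrA ler_pdivrMr// mul1r -(ler_pXn2r (n := 2)) ?nnegrE ?(ltW sK0)//; last order_lra.
  rewrite sqr_sqrtr// exprMn; order_lra.
have P1' j : (K <= j)%N -> (j <= N - K)%N -> P j <= 1.
  move=> Kj jK; apply: le_trans (P1 j Kj jK) _; apply: le_trans isqK1.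
  by rewrite ler_wpM2l//; order_lra.
have lK : 0 <= ln K%:R :> R by rewrite ln_ge0// ler1n; nat_lia.
have He j : (K <= j)%N -> (j <= N - K)%N -> nm (e j - H j) <= 1 ->
    1 + nm (e j) ^+ 2 <= C4 * Num.sqrt (minn j (N - j))%:R.
  move=> Kj jK r1; set d := minn j (N - j).
  have Kd : (K <= d)%N by rewrite leq_min; nat_lia.
  have dl : ln K%:R <= ln d.+1%:R :> R.
    by rewrite ler_ln ?posrE ?ltr0n ?ler_nat//; nat_lia.
  have hs := gate_drift_sum b n2 (ltnW K2n) ka0 kaM M0 Kj jK.
  have hH : nm (H j) <= C3 * (1 + ln d.+1%:R).
    apply: le_trans (modulusD _ _) _; apply: le_trans (lerD (lexx _) hs) _.
    have := modulusD (e K - b * rC (ln K%:R)) (b * rC (ln K%:R)).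
    rewrite subrK (modulusM b) modulus_rC ger0_norm// -/N -/d => h1.
    have h2 : nm b * ln K%:R <= nm b * ln d.+1%:R by rewrite ler_wpM2l.
    have h3 : 0 <= `|B| * ln d.+1%:R by rewrite mulr_ge0//; order_lra.
    have h4 := ler_norm B; rewrite /e in h1.
    by rewrite /C3; order_lra.
  have d0 : (0 < d)%N by nat_lia.
  have hl := ln_sqr_le_sqrt R d0.
  have he : nm (e j) <= nm (H j) + 1.
    by have := modulusD (e j - H j) (H j); rewrite subrK; order_lra.
  have sd : 1 <= Num.sqrt d%:R :> R by rewrite -[leLHS]sqrtr1 ler_wsqrtr// ler1n.
  exact: log_growth_sqr C30 (modulus_ge0 _) (modulus_ge0 _) sd hH hl he.
have claim j : (K <= j)%N -> (j <= N - K)%N -> nm (e j - H j) <= P j.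
  elim: j => [|j ih] Kj jK; first by nat_lia.
  have [Kj'|Kj'] := leqP K j; last first.
    have -> : j.+1 = K by nat_lia.
    by rewrite /H big_geq// addr0 subrr modulus0 /P !subrr !addr0 mulr0 mul0r addr0.
  have {}ih : nm (e j - H j) <= P j by apply: ih => //; nat_lia.
  have jK' : (j <= N - K)%N by nat_lia.
  have hsq := He j Kj' jK' (le_trans ih (P1' j Kj' jK')).
  set d := minn j (N - j) in hsq.
  have Kd : (K <= d)%N by rewrite leq_min; nat_lia.
  have KdR : K%:R <= d%:R :> R by rewrite ler_nat.
  have dw : d%:R / 6 <= gate_width R n j by apply: gate_width_ge_min => //; nat_lia.
  have d0 : 0 < d%:R :> R by order_lra.
  have w4 : 4 <= gate_width R n j by order_lra.
  have ew : nm (e j) <= gate_width R n j / 2.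
    by apply: small_deviation dw hsq; rewrite ?modulus_ge0//; order_lra.
  have [zS hc] := hz j Kj' ltac:(nat_lia).
  have j0 : (0 < j)%N by nat_lia.
  have jN : (j.+1 < 2 * n + 1)%N by nat_lia.
  have := hA n ka th j (z j) (c j) n2 j0 jN ka0 kaM thN1 hc w4 ew.
  rewrite -zS -/(e j.+1) -/(e j) => hstep.
  have -> : e j.+1 - H j.+1 = (e j - H j) + (e j.+1 - e j - gate_drift b ka n j).
    by rewrite /H big_nat_recr//=; ring.
  apply: le_trans (modulusD _ _) _; apply: le_trans (lerD ih hstep) _.
  rewrite -/(e j) -/N.
  have herr : A * (1 + nm (e j) ^+ 2) / gate_width R n j ^+ 2 <=
      C5 * (d%:R * Num.sqrt d%:R)^-1.
    exact: step_error_le dw hsq.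
  have hd : (d%:R * Num.sqrt d%:R)^-1 <= (j%:R * Num.sqrt j%:R)^-1 +
      ((N - j)%:R * Num.sqrt (N - j)%:R)^-1 :> R.
    rewrite /d /minn; case: ifP => _.
      by rewrite lerDl invr_ge0 mulr_ge0// sqrtr_ge0.
    by rewrite lerDr invr_ge0 mulr_ge0// sqrtr_ge0.
  have t1 : (j%:R * Num.sqrt j%:R)^-1 <= 2 * (isq j.-1 - isq j).
    by apply: telescope_sqrt; nat_lia.
  have t2 : ((N - j)%:R * Num.sqrt (N - j)%:R)^-1 <= 2 * (isq (N - j).-1 - isq (N - j)%N).
    by apply: telescope_sqrt; nat_lia.
  have hsum : C5 * (d%:R * Num.sqrt d%:R)^-1 <=
      C5 * (2 * (isq j.-1 - isq j) + 2 * (isq (N - j).-1 - isq (N - j)%N)).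
    by apply: ler_wpM2l => //; order_lra.
  rewrite /P subnS -(natr1 j) /=; order_lra.
have NK : (K <= N - K)%N by nat_lia.
have h1 := le_trans (claim _ NK (leqnn _)) (P1 _ NK (leqnn _)).
have h2 : nm (H (N - K)%N - e K) <= 6 * (nm b + 1 + M) * isq K.
  rewrite /H addrC addKr; apply: gate_drift_total => //; nat_lia.
have -> : gate_dev n (z (N - K)%N) (N - K) - gate_dev n (z K) K =
  (e (N - K)%N - H (N - K)%N) + (H (N - K)%N - e K) by rewrite /e; ring.
apply: le_trans (modulusD _ _) _; apply: le_trans (lerD h1 h2) _.
have : (4 * C5 + 1) * isq K.-1 <= (4 * C5 + 1) * (2 * isq K) by rewrite ler_wpM2l//; order_lra.
rewrite -/(isq K); order_lra.
Qed.

End GatePassage.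

(** * The forcing term *)

Section Forcing.
Variable R : realType.
Local Notation C := (Cplx R).
Local Notation nm := (@modulus R).

(** Half the rate at which (pi^2/4) / (n^2 + t) decreases at t = 0. *)
Definition gate_slope (n : nat) : R := pi ^+ 2 / (8 * n%:R ^+ 4).

Lemma pi_sqr_lt16 : pi ^+ 2 < 16 :> R.
Proof. by have := pi_lt4 R; have := @pi_gt0 R; nra. Qed.

Lemma gate_slope_le n : (1 <= n)%N -> gate_slope n * (2 * n + 1)%:R ^+ 4 <= 162.
Proof.
move=> n1; have N1 : 1 <= n%:R :> R by rewrite ler1n.
rewrite /gate_slope mulrAC ler_pdivrMr; last by rewrite mulr_gt0// exprn_gt0//; lra.
have h : (2 * n + 1)%:R ^+ 4 <= (3 * n%:R) ^+ 4 :> R.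
  by rewrite lerXn2r ?nnegrE ?mulr_ge0// natrD natrM; lra.
have := pi_sqr_lt16; have p0 : 0 <= pi ^+ 2 :> R by exact: sqr_ge0.
have h4 : 0 <= n%:R ^+ 4 :> R by rewrite exprn_ge0.
rewrite exprMn in h => h16.
apply: (@le_trans _ _ (16 * (81 * n%:R ^+ 4))); last lra.
apply: ler_pM => //; [exact: ltW|].
by apply: le_trans h _; lra.
Qed.

(** At time j = n + 1/4, close to mid-time, n^2 + j is (n + 1/2)^2 and the forcing is a^2
    for a = pi / (2 n + 1): this is why the constant pi^2/4 goes with 2 n + 1 steps. About
    this time the forcing is linear up to O(1/n^4). *)
Lemma forcing_real n j : (2 <= n)%N -> (j <= 2 * n + 1)%N ->
  `|pi ^+ 2 / 4 / (n ^ 2 + j)%:R - gate_tan R n ^+ 2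
    - gate_slope n * ((2 * n + 1)%:R - 2 * j%:R)| <= 116 / n%:R ^+ 4.
Proof.
move=> n2 jN; have [_ _ _ _ tb] := gate_tan_bounds R n2.
have N2 : 2 <= n%:R :> R by rewrite (ler_nat _ 2).
have J : j%:R <= 2 * n%:R + 1 :> R by rewrite -natrM natr1 ler_nat -addn1.
have J0 : 0 <= j%:R :> R by [].
have -> : (n ^ 2 + j)%:R = n%:R ^+ 2 + j%:R :> R by rewrite natrD natrX.
have a4 : 3 * gate_angle R n ^+ 4 <= 48 / n%:R ^+ 4.
  have h : gate_angle R n <= 2 / n%:R.
    rewrite /gate_angle ler_pdivrMr ?odd_natr_gt0//.
    rewrite mulrAC ler_pdivlMr ?natrD ?natrM; last order_lra.
    have : pi * n%:R <= 4 * n%:R :> R by rewrite ler_wpM2r// ltW// pi_lt4.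
    by order_lra.
  have : gate_angle R n ^+ 4 <= (2 / n%:R) ^+ 4.
    have a0 := ltW (gate_angle_gt0 R n); have x0 : 0 <= 2 / n%:R :> R by rewrite divr_ge0.
    by rewrite lerXn2r ?nnegrE.
  by rewrite exprMn exprVn; order_lra.
have aE : gate_angle R n ^+ 2 = pi ^+ 2 / 4 / (n%:R ^+ 2 + n%:R + 1 / 4).
  rewrite /gate_angle natrD natrM exprMn exprVn.
  have -> : (2 * n%:R + 1) ^+ 2 = 4 * (n%:R ^+ 2 + n%:R + 1 / 4) :> R by field.
  by rewrite invfM mulrA.
move: tb aE a4; set t2 := gate_tan R n ^+ 2; set a2 := gate_angle R n ^+ 2.
set a4 := gate_angle R n ^+ 4 => tb aE ha4.
rewrite natrD natrM.
move: N2 J J0 aE ha4; rewrite /gate_slope; set x : R := n%:R; set y : R := j%:R.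
move=> x2 yx y0 aE ha4.
have p0 : 0 <= pi ^+ 2 :> R by exact: sqr_ge0.
have p16 := pi_sqr_lt16; set p : R := pi ^+ 2 in aE p0 p16 *.
set m := x ^+ 2 + y; set q := x ^+ 2 + x + 1 / 4 in aE.
have x0 : 0 < x ^+ 2 by rewrite exprn_gt0//; order_lra.
have m0 : 0 < m by rewrite /m; order_lra.
have q0 : 0 < q by rewrite /q; order_lra.
have x4 : 0 < x ^+ 4 by rewrite exprn_gt0//; order_lra.
have mq : x ^+ 4 <= m * q.
  have -> : x ^+ 4 = x ^+ 2 * x ^+ 2 by ring.
  by apply: ler_pM; rewrite ?(ltW x0)// /m /q; order_lra.
have mq2 : m * q <= x ^+ 4 + 11 * x ^+ 3.
  apply: (@le_trans _ _ ((x ^+ 2 + 3 * x) * (x ^+ 2 + 2 * x))).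
    by apply: ler_pM; rewrite ?(ltW m0) ?(ltW q0)// /m /q; order_lra.
  have : x ^+ 2 * 2 <= x ^+ 2 * x by rewrite ler_wpM2l// ltW.
  have -> : (x ^+ 2 + 3 * x) * (x ^+ 2 + 2 * x) = x ^+ 4 + 5 * (x ^+ 2 * x) + 6 * x ^+ 2 by ring.
  have -> : x ^+ 3 = x ^+ 2 * x by ring.
  by order_lra.
have -> : p / 4 / m - t2 - p / (8 * x ^+ 4) * (2 * x + 1 - 2 * y) =
  - (t2 - a2) - p / 8 * (1 / 2 / (m * q)
    + (2 * x + 1 - 2 * y) * ((m * q - x ^+ 4) / (x ^+ 4 * (m * q)))).
  rewrite aE.
  have -> : y = m - x ^+ 2 by rewrite /m; ring.
  have qE : x = q - x ^+ 2 - 1 / 4 by rewrite /q; ring.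
  have xn : x != 0 by rewrite gt_eqF//; order_lra.
  have mn : m != 0 by rewrite gt_eqF.
  have qn : q != 0 by rewrite gt_eqF.
  rewrite [X in _ * (2 * X + 1 - _)]qE [X in _ + (2 * X + 1 - _) * _]qE.
  by move: m q xn mn qn {qE aE x0 x4 mq mq2 m0 q0} => m q xn mn qn; field; rewrite xn mn qn.
have d1 : `|(m * q - x ^+ 4) / (x ^+ 4 * (m * q))| <= 11 / (x * x ^+ 4).
  rewrite ger0_norm; last by rewrite divr_ge0 ?mulr_ge0 ?(ltW x4) ?(ltW m0) ?(ltW q0)//; order_lra.
  have xx4 : 0 < x * x ^+ 4 by rewrite mulr_gt0//; order_lra.
  rewrite ler_pdivlMr// mulrAC ler_pdivrMr; last by rewrite mulr_gt0// mulr_gt0.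
  have h1 : (m * q - x ^+ 4) * (x * x ^+ 4) <= 11 * x ^+ 3 * (x * x ^+ 4).
    by apply: ler_wpM2r; [exact: ltW|order_lra].
  have -> : 11 * (x ^+ 4 * (m * q)) = 11 * x ^+ 4 * (m * q) by ring.
  apply: le_trans h1 _; have -> : 11 * x ^+ 3 * (x * x ^+ 4) = 11 * x ^+ 4 * x ^+ 4 by ring.
  by apply: ler_wpM2l => //; rewrite mulr_ge0// ltW.
have d2 : `|2 * x + 1 - 2 * y| <= 3 * x by rewrite ler_norml; order_lra.
have d3 : `|1 / 2 / (m * q)| <= 1 / 2 / x ^+ 4.
  rewrite ger0_norm; last by rewrite divr_ge0// mulr_ge0// ltW.
  by rewrite ler_wpM2l// lef_pV2 ?posrE// mulr_gt0.
have d4 : `|(2 * x + 1 - 2 * y) * ((m * q - x ^+ 4) / (x ^+ 4 * (m * q)))| <= 33 / x ^+ 4.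
  rewrite normrM; apply: le_trans (ler_pM _ _ d2 d1) _ => //.
  rewrite le_eqVlt; apply/orP; left; apply/eqP; field.
  by rewrite gt_eqF//; order_lra.
apply: le_trans (ler_normB _ _) _; rewrite normrN.
have d5 : `|p / 8 * (1 / 2 / (m * q) + (2 * x + 1 - 2 * y) *
    ((m * q - x ^+ 4) / (x ^+ 4 * (m * q))))| <= 2 * (34 / x ^+ 4).
  rewrite normrM; apply: ler_pM; rewrite ?normr_ge0//.
    by rewrite ger0_norm; order_lra.
  have xv : 0 < (x ^+ 4)^-1 by rewrite invr_gt0.
  by apply: le_trans (ler_normD _ _) _; apply: le_trans (lerD d3 d4) _; order_lra.
have xv : 0 < (x ^+ 4)^-1 by rewrite invr_gt0.
order_lra.
Qed.

(** For m = n^2 + j the error log m on 1 / w changes w by O(log n / n^4) only, and any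
    bound o(n^(-3)) suffices to cross the gate. *)
Lemma forcing_le (A : R) : 0 <= A -> exists2 B : R, 0 <= B & exists n0 : nat,
  forall n j (w : C), (n0 <= n)%N -> (j <= 2 * n + 1)%N ->
    nm (w^-1 - (n ^ 2 + j)%:R) <= A * (1 + ln (n ^ 2 + j)%:R) ->
    nm (rC (pi ^+ 2 / 4) * w - rC (gate_tan R n ^+ 2)
        - rC (gate_slope n * ((2 * n + 1)%:R - 2 * j%:R))) <=
      B / (n%:R ^+ 3 * Num.sqrt n%:R).
Proof.
move=> A0; exists (800 * A + 116); first order_lra.
pose n0 := (Num.trunc (200 * A)).+2; exists n0 => n j w nn0 jN hw.
have n2 : (2 <= n)%N by apply: leq_trans nn0.
have nA : 200 * A <= n%:R.
  have h1 : (Num.trunc (200 * A)).+1%:R <= n%:R :> R by rewrite ler_nat ltnW.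
  by apply: le_trans h1; rewrite ltW// truncnS_gt.
have N2 : 2 <= n%:R :> R by rewrite (ler_nat _ 2).
set m := (n ^ 2 + j)%N in hw *.
have nm1 : n%:R ^+ 2 <= m%:R :> R by rewrite -natrX ler_nat leq_addr.
have m0 : 0 < m%:R :> R by apply: lt_le_trans nm1; rewrite exprn_gt0//; order_lra.
have sn0 : 0 < Num.sqrt n%:R :> R by rewrite sqrtr_gt0; order_lra.
have sn2 : Num.sqrt n%:R ^+ 2 = n%:R :> R by rewrite sqr_sqrtr//; order_lra.
have sn1 : 1 <= Num.sqrt n%:R :> R by rewrite -[leLHS]sqrtr1 ler_wsqrtr//; order_lra.
have hl : 1 + ln m%:R <= 100 * Num.sqrt n%:R :> R.
  have h1 : ln m%:R <= 2 * ln n.+1%:R :> R.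
    have -> : 2 * ln n.+1%:R = ln (n.+1%:R ^+ 2) :> R by rewrite lnXn// mulr_natl.
    rewrite ler_ln ?posrE ?exprn_gt0// -natrX ler_nat /m; lia.
  have n1 : (0 < n)%N by lia.
  have := ln_sqr_le_sqrt R n1.
  have l0 : 0 <= ln n.+1%:R :> R by rewrite ln_ge0// ler1n.
  by have := sqr_ge0 (ln n.+1%:R : R); order_lra.
have hA : A * (1 + ln m%:R) <= A * (100 * Num.sqrt n%:R) by rewrite ler_wpM2l.
have hm : A * (100 * Num.sqrt n%:R) <= m%:R / 2.
  have h1 : 200 * A * Num.sqrt n%:R <= n%:R * n%:R.
    apply: ler_pM => //; rewrite ?mulr_ge0 ?sqrtr_ge0//.
    by rewrite -{2}sn2 expr2 ler_peMl// ltW.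
  by rewrite -expr2 in h1; order_lra.
have nmm : nm (m%:R : C) = m%:R by rewrite -rC_nat modulus_rC normr_nat.
have hw2 : m%:R / 2 <= nm w^-1.
  have := modulus_subr (m%:R : C) (m%:R - w^-1); rewrite subKr nmm modulus_sym; order_lra.
have w0 : w != 0.
  apply/eqP => wz; move: hw2; rewrite wz invr0 modulus0; order_lra.
have hd : nm (w - (m%:R)^-1) <= 200 * A / (n%:R ^+ 3 * Num.sqrt n%:R).
  have -> : w - m%:R^-1 = - ((w^-1 - m%:R) / (w^-1 * m%:R)).
    have mn : (m%:R : C) != 0 by rewrite -modulus_gt0 nmm.
    by field; rewrite w0 mn.
  rewrite modulusN modulusM modulusV modulusM nmm.
  rewrite ler_pdivrMr; last by rewrite mulr_gt0//; order_lra.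
  apply: (le_trans (le_trans hw hA)).
  rewrite mulrAC ler_pdivlMr; last by rewrite mulr_gt0// exprn_gt0//; order_lra.
  have -> : A * (100 * Num.sqrt n%:R) * (n%:R ^+ 3 * Num.sqrt n%:R) =
    100 * A * n%:R ^+ 3 * Num.sqrt n%:R ^+ 2 by ring.
  rewrite sn2; have -> : 100 * A * n%:R ^+ 3 * n%:R = 200 * A * (n%:R ^+ 2 / 2 * n%:R ^+ 2) by field.
  apply: ler_wpM2l; first order_lra.
  by apply: ler_pM => //; rewrite ?mulr_ge0 ?exprn_ge0//; order_lra.
have hr := forcing_real n2 jN; rewrite -/m in hr.
have -> : rC (pi ^+ 2 / 4) * w - rC (gate_tan R n ^+ 2)
    - rC (gate_slope n * ((2 * n + 1)%:R - 2 * j%:R)) =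
  rC (pi ^+ 2 / 4) * (w - m%:R^-1) + rC (pi ^+ 2 / 4 / m%:R - gate_tan R n ^+ 2
    - gate_slope n * ((2 * n + 1)%:R - 2 * j%:R)).
  by rewrite !rCB (rCM (pi ^+ 2 / 4)) rCV rC_nat; ring.
apply: le_trans (modulusD _ _) _; rewrite modulusM !modulus_rC.
have p4 : `|pi ^+ 2 / 4 : R| <= 4.
  have p16 := pi_sqr_lt16; have p0 := sqr_ge0 (pi : R).
  by rewrite ger0_norm; order_lra.
have h2 : `|pi ^+ 2 / 4 : R| * nm (w - m%:R^-1) <=
    4 * (200 * A / (n%:R ^+ 3 * Num.sqrt n%:R)).
  by apply: ler_pM; rewrite ?modulus_ge0.
have h3 : 116 / n%:R ^+ 4 <= 116 / (n%:R ^+ 3 * Num.sqrt n%:R) :> R.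
  have nR0 : 0 < n%:R :> R by order_lra.
  apply: ler_wpM2l => //; rewrite lef_pV2 ?posrE ?mulr_gt0 ?exprn_gt0//.
  rewrite [leRHS]exprSr; apply: ler_wpM2l; first by rewrite exprn_ge0// ltW.
  by rewrite -{2}sn2 expr2 ler_peMl// ltW.
order_lra.
Qed.

End Forcing.

(** * Limits for a fixed number of steps *)

Section FixedSteps.
Variable R : realType.
Local Notation C := (Cplx R).
Local Notation Re := (@complex.Re R).
Local Notation nm := (@modulus R).

Lemma gate_angle_cvg0 : gate_angle R n @[n --> \oo] --> (0 : R).
Proof.
have h : (0 : R) @[n --> \oo] --> (0 : R) by exact: cvg_cst.
apply: (squeeze_cvgr (f := fun=> 0) (h := fun n => pi * harmonic n)) h _.
  near=> n; rewrite ltW ?gate_angle_gt0//=.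
  rewrite /gate_angle /harmonic /= ler_wpM2l ?pi_ge0//.
  by rewrite lef_pV2 ?posrE ?ltr0n ?addn1// ler_nat; lia.
rewrite -[X in _ --> X](mulr0 pi); apply: cvgM; [exact: cvg_cst|exact: cvg_harmonic].
Unshelve. all: by end_near. Qed.

Lemma gate_cos_cvg j : cos (j%:R * gate_angle R n) @[n --> \oo] --> (1 : R).
Proof.
have h : j%:R * gate_angle R n @[n --> \oo] --> (j%:R * 0 : R).
  by apply: cvgM; [exact: cvg_cst|exact: gate_angle_cvg0].
rewrite mulr0 in h; rewrite -[X in _ --> X](@cos0 R).
exact: (continuous_cvg _ (@continuous_cos R 0) h).
Qed.

Lemma gate_width_cvg j : gate_width R n j @[n --> \oo] --> (j%:R : R).
Proof.
elim: j => [|j ih].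
  rewrite (_ : (fun n => gate_width R n 0) = (fun=> 0)); first exact: cvg_cst.
  by apply/funext => n; rewrite /gate_width mul0r sin0 mul0r.
have h : (gate_width R n j + cos (j%:R * gate_angle R n)) * cos (1%:R * gate_angle R n)
    @[n --> \oo] --> ((j%:R + 1) * 1 : R).
  by apply: cvgM; [apply: cvgD|]; [exact: ih|exact: gate_cos_cvg|exact: gate_cos_cvg].
rewrite -natr1 -[X in _ --> X]mulr1; apply: cvg_trans h; apply: near_eq_cvg.
near=> n; have n2 : (2 <= n)%N by near: n; exists 2%N.
have [t0 _ _ _ _] := gate_tan_bounds R n2.
have c0 : cos (gate_angle R n) != 0.
  by apply/eqP => c0; move: t0; rewrite /gate_tan /tan c0 invr0 mulr0 ltxx.
rewrite /gate_width -(natr1 j) (mulrDl j%:R) mul1r sinD.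
have -> : sin (gate_angle R n) = gate_tan R n * cos (gate_angle R n).
  by rewrite /gate_tan /tan mulfVK.
by field; rewrite gt_eqF.
Unshelve. all: by end_near. Qed.

Lemma gate_orbit_cvg j : (0 < j)%N ->
  gate_orbit R n j @[n --> \oo] --> (- (j%:R)^-1 : R).
Proof.
move=> j0; rewrite -mulN1r; apply: cvgM.
  by apply: cvgN; exact: gate_cos_cvg.
by apply: cvgV; [rewrite pnatr_eq0 -lt0n|exact: gate_width_cvg].
Qed.

(** For a fixed step j, the elliptic orbit tends to the parabolic one, - 1/j, as n tends
    to infinity. *)
Lemma gate_dev_cvg (j : nat) (B d : R) : (0 < j)%N -> 0 < d ->
  \forall n \near \oo, forall z, nm z <= B ->
    nm (gate_dev n z j - (j%:R) ^+ 2 * (z + (j%:R)^-1)) <= d.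
Proof.
move=> j0 d0; have j0' : (j%:R : R) != 0 by rewrite pnatr_eq0 -lt0n.
have B1 : 0 < `|B| + 1 by rewrite ltr_wpDl.
have h1 : gate_width R n j ^+ 2 @[n --> \oo] --> (j%:R ^+ 2 : R).
  by rewrite !expr2; apply: cvgM; exact: gate_width_cvg.
have h2 : gate_width R n j ^+ 2 * gate_orbit R n j @[n --> \oo] -->
    (j%:R ^+ 2 * - (j%:R)^-1 : R).
  by apply: cvgM => //; exact: gate_orbit_cvg.
have d1 : 0 < d / 2 / (`|B| + 1) by rewrite !divr_gt0.
have d2 : 0 < d / 2 by rewrite divr_gt0.
move: h1 => /cvgrPdist_le/(_ _ d1); move: h2 => /cvgrPdist_le/(_ _ d2).
apply: filterS2 => n hn2 hn1 z zB.
have -> : gate_dev n z j - (j%:R) ^+ 2 * (z + (j%:R)^-1) =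
  rC (j%:R ^+ 2 * - (j%:R)^-1 - gate_width R n j ^+ 2 * gate_orbit R n j)
  - rC (j%:R ^+ 2 - gate_width R n j ^+ 2) * z.
  rewrite /gate_dev !(rCB, rCN, rCM (j%:R ^+ 2), rCM (gate_width R n j ^+ 2), rCX, rCV, rC_nat).
  by ring.
apply: le_trans (modulusB _ _) _; rewrite modulusM !modulus_rC.
have : `|j%:R ^+ 2 - gate_width R n j ^+ 2| * nm z <= d / 2 / (`|B| + 1) * (`|B| + 1).
  apply: ler_pM => //; first exact: modulus_ge0.
  by have := ler_norm B; lra.
rewrite divfK ?gt_eqF//; lra.
Qed.

Lemma iter_perturbation (f : {poly C}) (K : nat) (B e : R) : 0 < e ->
  exists2 d : R, 0 < d & forall z c : nat -> C, nm (z 0%N) <= B ->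
    (forall j, (j < K)%N -> z j.+1 = f.[z j] + c j /\ nm (c j) <= d) ->
    nm (z K - iter K (horner f) (z 0%N)) <= e.
Proof.
elim: K e => [|K ih] e e0.
  by exists 1 => // z c _ _; rewrite /= subrr modulus0 ltW.
have [L [M L0 hL]] := poly_iter_lipschitz f B K.
have [L1 L10 hL1] := poly_lipschitz f (M + 1).
have e1 : 0 < Num.min 1 (e / 2 / (L1 + 1)).
  by rewrite lt_min ltr01 !divr_gt0//; lra.
have [d d0 hd] := ih _ e1; exists (Num.min d (e / 2)); first by rewrite lt_min d0 divr_gt0.
move=> z c zB hz.
have := hd z c zB; have hK j : (j < K)%N -> z j.+1 = f.[z j] + c j /\ nm (c j) <= d.
  by move=> jK; have [zS] := hz j (leqW jK); rewrite le_min => /andP[].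
move=> /(_ hK); rewrite le_min => /andP[h1 h2].
have [iM _] := hL _ _ zB zB.
have zM : nm (z K) <= M + 1.
  by have := modulus_subr (z K) (iter K (horner f) (z 0%N)); lra.
have [-> ] := hz K (leqnn _); rewrite le_min => /andP[_ hc].
rewrite iterS addrAC; apply: le_trans (modulusD _ _) _.
have := hL1 _ _ zM (ler_wpDr ler01 iM).
rewrite ler_pdivlMr in h2; last lra.
have := modulus_ge0 (z K - iter K (horner f) (z 0%N)).
by nra.
Qed.

Lemma logC_scale (r : R) (z : C) : 0 < r -> 0 < Re z -> logC (rC r * z) = rC (ln r) + logC z.
Proof.
move=> r0; case: z => x y /= x0; rewrite /logC /rC /=.
rewrite !mul0r subr0 addr0.
set s := Num.sqrt (x ^+ 2 + y ^+ 2).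
have -> : Num.sqrt ((r * x) ^+ 2 + (r * y) ^+ 2) = r * s.
  by rewrite !exprMn -mulrDr sqrtrM ?sqr_ge0// sqrtr_sqr gtr0_norm.
have s0 : 0 < s by rewrite sqrtr_gt0 ltr_pwDl ?sqr_ge0// exprn_gt0.
rewrite lnM ?posrE//.
have -> : r * y / (r * s + r * x) = y / (s + x).
  by rewrite -mulrDr invfM mulrACA divff ?mul1r// gt_eqF.
by apply/eqP; rewrite eq_complex /= add0r !eqxx.
Qed.

(** Uniform in p by homogeneity, the logarithm being continuous at 1. *)
Lemma logC_near (e : R) : 0 < e -> exists2 d : R, 0 < d &
  forall (p : R) (z : C), 0 < p -> nm (z - rC p) <= d * p -> nm (logC z - rC (ln p)) < e.
Proof.
move=> e0; have s1 : slit_plane (1 : C) by right; exact: ltr01.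
have /cvg_modulusP/(_ e e0)/nbhs_modulusP[d d0 hd] := continuous_logC s1.
pose d' := Num.min (d / 2) (1 / 2).
have d'0 : 0 < d' by rewrite lt_min !divr_gt0.
exists d' => // p z p0 zp.
have pn : rC p != 0 by rewrite rC_eq0 gt_eqF.
pose u := z / rC p.
have uE : z = rC p * u by rewrite /u mulrCA mulfV// mulr1.
have u1 : nm (u - 1) <= d'.
  have -> : u - 1 = (z - rC p) / rC p by rewrite /u mulrBl mulfV.
  by rewrite modulusM modulusV modulus_rC gtr0_norm// ler_pdivrMr.
have [ud uh] : nm (u - 1) <= d / 2 /\ nm (u - 1) <= 1 / 2.
  by move: u1; rewrite /d' le_min => /andP.
have Ru : 0 < Re u.
  have := modulus_ge_Re (u - 1); rewrite ReD ReN ler_norml => /andP[+ _].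
  have -> : Re 1 = 1 by [].
  lra.
rewrite uE logC_scale// addrAC subrr add0r.
have := hd u; rewrite logC1 subr0; apply; lra.
Qed.

(** Near the point - 1/p, the deviation E = p^2 (z + 1/p) and the displacement Z - p of
    the chart satisfy E = p (Z - p) / Z, so they differ by a quadratic term. *)
Lemma chart_dev (p m : R) (z : C) : 0 < m -> m <= `|p| / 2 ->
  nm (chart z - rC p) <= m ->
  nm (rC p ^+ 2 * (z + (rC p)^-1) - (chart z - rC p)) <= 2 * m ^+ 2 / `|p|.
Proof.
move=> m0 mp hz; have p0 : 0 < `|p| by lra.
have pn : rC p != 0 by rewrite rC_eq0 -normr_gt0.
have cz : `|p| / 2 <= nm (chart z).
  by have := modulus_subr (rC p) (rC p - chart z); rewrite subKr modulus_sym modulus_rC; lra.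
have c0 : chart z != 0 by rewrite -modulus_gt0; lra.
have -> : rC p ^+ 2 * (z + (rC p)^-1) - (chart z - rC p) = - ((chart z - rC p) ^+ 2 / chart z).
  have zE : z = - (chart z)^-1 by rewrite -[RHS]/(chart _) chartK.
  move: c0 zE; set Z := chart z => c0 zE.
  by rewrite zE; field; rewrite c0 pn.
rewrite modulusN modulusM modulusV modulusX ler_pdivrMr; last lra.
have h : nm (chart z - rC p) ^+ 2 <= m ^+ 2 by rewrite lerXn2r ?nnegrE ?modulus_ge0// ltW.
apply: le_trans h _.
have -> : 2 * m ^+ 2 / `|p| * nm (chart z) = m ^+ 2 * (nm (chart z) / (`|p| / 2)).
  by field; rewrite gt_eqF.
by rewrite ler_peMr ?sqr_ge0// ler_pdivlMr ?mul1r//; lra.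
Qed.

Lemma dev_chart (p m : R) (z : C) : 0 < m -> m <= `|p| / 2 ->
  nm (rC p ^+ 2 * (z + (rC p)^-1)) <= m ->
  z != 0 /\
  nm (chart z - rC p - rC p ^+ 2 * (z + (rC p)^-1)) <= 2 * m ^+ 2 / `|p|.
Proof.
move=> m0 mp; have p0 : 0 < `|p| by lra.
have pn : rC p != 0 by rewrite rC_eq0 -normr_gt0.
set E := _ * (z + _) => hE.
have zE : z = (E - rC p) / rC p ^+ 2 by rewrite /E; field.
have Ep : `|p| / 2 <= nm (E - rC p).
  by have := modulus_subr (rC p) E; rewrite modulus_sym modulus_rC; lra.
have Ep0 : E - rC p != 0 by rewrite -modulus_gt0; lra.
split; first by rewrite zE mulf_neq0// invr_neq0// expf_neq0.
have -> : chart z - rC p - E = - (E ^+ 2 / (E - rC p)).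
  by rewrite /chart {1}zE; field; rewrite Ep0 pn.
rewrite modulusN modulusM modulusV modulusX ler_pdivrMr; last lra.
have h : nm E ^+ 2 <= m ^+ 2 by rewrite lerXn2r ?nnegrE ?modulus_ge0// ltW.
apply: le_trans h _.
have -> : 2 * m ^+ 2 / `|p| * nm (E - rC p) = m ^+ 2 * (nm (E - rC p) / (`|p| / 2)).
  by field; rewrite gt_eqF.
by rewrite ler_peMr ?sqr_ge0// ler_pdivlMr ?mul1r//; lra.
Qed.

End FixedSteps.

(** * Entry and exit *)

Section EntryExit.
Variable R : realType.
Local Notation C := (Cplx R).
Local Notation Re := (@complex.Re R).
Local Notation nm := (@modulus R).

Lemma near_sqrt_ge (A e : R) : 0 <= A -> 0 < e -> \forall K \near \oo, A <= e * Num.sqrt K%:R.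
Proof.
move=> A0 e0; near=> K.
have h : (A / e) ^+ 2 <= K%:R by near: K; exact: nbhs_infty_ger.
have : A / e <= Num.sqrt K%:R.
  by rewrite -[leLHS]ger0_norm ?divr_ge0 ?(ltW e0)// -sqrtr_sqr ler_wsqrtr.
by rewrite ler_pdivrMr// mulrC.
Unshelve. all: by end_near. Qed.

Lemma near_log_sqr (A e : R) : 0 <= A -> 0 < e ->
  \forall K \near \oo, A * (1 + ln K%:R) ^+ 2 <= e * K%:R.
Proof.
move=> A0 e0; near=> K.
have K0 : (0 < K)%N by near: K; exists 1%N.
have KR : 0 < K%:R :> R by rewrite ltr0n.
have h1 : 50 * A <= e * Num.sqrt K%:R.
  by near: K; apply: near_sqrt_ge => //; rewrite mulr_ge0.
have l0 : 0 <= ln K%:R :> R by rewrite ln_ge0// ler1n.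
have h2 : (1 + ln K%:R) ^+ 2 <= 50 * Num.sqrt K%:R :> R.
  apply: le_trans (ln_sqr_le_sqrt R K0); rewrite lerXn2r ?nnegrE ?addr_ge0//.
    by rewrite ln_ge0// ler1n.
  by rewrite lerD2l ler_ln ?posrE ?ltr0n// ler_nat.
have s2 : Num.sqrt K%:R ^+ 2 = K%:R :> R by rewrite sqr_sqrtr// ltW.
apply: (@le_trans _ _ (A * (50 * Num.sqrt K%:R))); first by rewrite ler_wpM2l.
rewrite -{2}s2 expr2 !mulrA [A * _]mulrC.
by rewrite ler_wpM2r ?sqrtr_ge0.
Unshelve. all: by end_near. Qed.

Lemma near_log (A e : R) : 0 <= A -> 0 < e ->
  \forall K \near \oo, A * (1 + ln K%:R) <= e * K%:R.
Proof.
move=> A0 e0; near=> K; have K0 : (0 < K)%N by near: K; exists 1%N.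
apply: (@le_trans _ _ (A * (1 + ln K%:R) ^+ 2)); last by near: K; exact: near_log_sqr.
have l0 : 0 <= ln K%:R :> R by rewrite ln_ge0// ler1n.
by apply: ler_wpM2l => //; rewrite expr2 ler_peMl//; lra.
Unshelve. all: by end_near. Qed.

(** In the chart a parabolic germ is nearly an isometry: the terms of order one of the
    distortion cancel, whence a summable factor 1 + O(1/i^2) along an orbit of size 1/i. *)
Lemma chart_distortion (f q : {poly C}) :
  (forall z, f.[z] = z + z ^+ 2 + z ^+ 3 * q.[z]) ->
  exists A : R, exists2 r : R, 0 <= A /\ 0 < r &
  forall z v, 0 < nm z <= r -> 0 < nm v <= r ->
    [/\ f.[z] != 0, f.[v] != 0 &
    nm (chart f.[z] - chart f.[v]) <=
      nm (chart z - chart v) * (1 + A * (nm z + nm v) ^+ 2)].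
Proof.
move=> fE; have [Q Q0 hQ] := poly_bounded q 1; have [L L0 hL] := poly_lipschitz q 1.
set D := Q + L + (1 + 4 * Q + Q ^+ 2).
have D0 : 0 <= D by rewrite /D; have := sqr_ge0 Q; lra.
set r : R := (2 * (1 + Q))^-1.
have r0 : 0 < r by rewrite invr_gt0; lra.
have rE : r * (2 * (1 + Q)) = 1 by rewrite mulVf// gt_eqF//; lra.
have r1 : r <= 1 by nra.
exists (4 * D), r; first by split=> //; lra.
have low z : 0 < nm z <= r -> f.[z] = z * (1 + z + z ^+ 2 * q.[z]) /\
    1 / 2 <= nm (1 + z + z ^+ 2 * q.[z]).
  move=> /andP[z0 zr]; split; first by rewrite fE; ring.
  have z1 : nm z <= 1 by lra.
  have := modulus_addr 1 (z + z ^+ 2 * q.[z]); rewrite modulus1 addrA.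
  have := modulusD z (z ^+ 2 * q.[z]); rewrite modulusM modulusX.
  have : nm z ^+ 2 * nm q.[z] <= nm z * Q.
    apply: ler_pM; rewrite ?exprn_ge0 ?modulus_ge0//; last exact: hQ.
    by rewrite expr2 ler_piMl// ltW.
  by nra.
move=> z v hz hv; have [fz kz] := low z hz; have [fv kv] := low v hv.
case/andP: hz => z0 zr; case/andP: hv => v0 vr.
have z1 : nm z <= 1 by lra.
have v1 : nm v <= 1 by lra.
have zn : z != 0 by rewrite -modulus_gt0.
have vn : v != 0 by rewrite -modulus_gt0.
have [hqz hqv] := (hQ z z1, hQ v v1); have hqL := hL z v z1 v1.
move: fz fv kz kv hqz hqv hqL; set qz := q.[z]; set qv := q.[v].
move=> -> -> kz kv hqz hqv hqL.
have kzn : 1 + z + z ^+ 2 * qz != 0 by rewrite -modulus_gt0; lra.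
have kvn : 1 + v + v ^+ 2 * qv != 0 by rewrite -modulus_gt0; lra.
split; [exact: mulf_neq0|exact: mulf_neq0|].
set s := nm z + nm v.
pose X := (z ^+ 2 + z * v + v ^+ 2) * (z - v) * qz + v ^+ 3 * (qz - qv).
pose Y := z * v + z ^+ 2 * qz * (1 + v) + v ^+ 2 * qv * (1 + z) + (z ^+ 2 * qz) * (v ^+ 2 * qv).
have E : chart (z * (1 + z + z ^+ 2 * qz)) - chart (v * (1 + v + v ^+ 2 * qv)) =
    (chart z - chart v) + (X - (z - v) * Y) /
      (z * v * ((1 + z + z ^+ 2 * qz) * (1 + v + v ^+ 2 * qv))).
  rewrite /chart /X /Y; field; rewrite kzn kvn zn vn.
  by [].
have s2 : s ^+ 2 = nm z ^+ 2 + 2 * (nm z * nm v) + nm v ^+ 2 by rewrite /s; ring.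
have zv0 : 0 <= nm z * nm v by rewrite mulr_ge0 ?modulus_ge0.
have zz0 := sqr_ge0 (nm z); have vv0 := sqr_ge0 (nm v).
have d0 := modulus_ge0 (z - v).
have ss0 := sqr_ge0 s.
have hX : nm X <= nm (z - v) * (s ^+ 2 * (Q + L)).
  apply: le_trans (modulusD _ _) _; rewrite 3!modulusM modulusX.
  have h1 : nm (z ^+ 2 + z * v + v ^+ 2) <= s ^+ 2.
    apply: le_trans (modulusD _ _) _; apply: le_trans (lerD (modulusD _ _) (lexx _)) _.
    by rewrite !modulusX modulusM; lra.
  have h2 : nm (z ^+ 2 + z * v + v ^+ 2) * nm (z - v) * nm qz <= s ^+ 2 * nm (z - v) * Q.
    by apply: ler_pM; rewrite ?mulr_ge0 ?modulus_ge0// ler_wpM2r.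
  have h3 : nm v ^+ 3 * nm (qz - qv) <= s ^+ 2 * (L * nm (z - v)).
    apply: ler_pM; rewrite ?exprn_ge0 ?modulus_ge0//.
    have : nm v ^+ 3 <= nm v ^+ 2 by rewrite exprS ler_piMl.
    lra.
  lra.
have hY : nm Y <= s ^+ 2 * (1 + 4 * Q + Q ^+ 2).
  have a1 : nm (z ^+ 2 * qz) <= nm z ^+ 2 * Q by rewrite modulusM modulusX ler_wpM2l.
  have a2 : nm (v ^+ 2 * qv) <= nm v ^+ 2 * Q by rewrite modulusM modulusX ler_wpM2l.
  have b1 : nm (1 + v) <= 2 by have := modulusD 1 v; rewrite modulus1; lra.
  have b2 : nm (1 + z) <= 2 by have := modulusD 1 z; rewrite modulus1; lra.
  have c1 : nm (z ^+ 2 * qz * (1 + v)) <= nm z ^+ 2 * Q * 2.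
    by rewrite modulusM ler_pM ?modulus_ge0.
  have c2 : nm (v ^+ 2 * qv * (1 + z)) <= nm v ^+ 2 * Q * 2.
    by rewrite modulusM ler_pM ?modulus_ge0.
  have c3 : nm ((z ^+ 2 * qz) * (v ^+ 2 * qv)) <= nm z ^+ 2 * Q * Q.
    rewrite modulusM ler_pM ?modulus_ge0//; apply: le_trans a2 _.
    by rewrite ler_piMl// expr_le1// modulus_ge0.
  have Qz : 0 <= Q * (nm z * nm v) by rewrite mulr_ge0.
  have Qzz : 0 <= Q * nm z ^+ 2 by rewrite mulr_ge0.
  have Qvv : 0 <= Q * nm v ^+ 2 by rewrite mulr_ge0.
  have QQ : nm z ^+ 2 * Q ^+ 2 <= s ^+ 2 * Q ^+ 2.
    by rewrite ler_wpM2r ?sqr_ge0//; lra.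
  have sQ : s ^+ 2 * Q = nm z ^+ 2 * Q + 2 * (nm z * nm v) * Q + nm v ^+ 2 * Q.
    by rewrite s2; ring.
  have h0 := modulusM z v.
  have := modulusD (z * v + z ^+ 2 * qz * (1 + v) + v ^+ 2 * qv * (1 + z))
    ((z ^+ 2 * qz) * (v ^+ 2 * qv)).
  have := modulusD (z * v + z ^+ 2 * qz * (1 + v)) (v ^+ 2 * qv * (1 + z)).
  have := modulusD (z * v) (z ^+ 2 * qz * (1 + v)).
  rewrite -/Y; lra.
have hN : nm (X - (z - v) * Y) <= nm (z - v) * (s ^+ 2 * D).
  apply: le_trans (modulusB _ _) _; rewrite (modulusM (z - v)).
  have : nm (z - v) * nm Y <= nm (z - v) * (s ^+ 2 * (1 + 4 * Q + Q ^+ 2)) by rewrite ler_wpM2l.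
  by rewrite /D; lra.
rewrite E; apply: le_trans (modulusD _ _) _; rewrite [leRHS]mulrDr mulr1 lerD2l.
have -> : chart z - chart v = (z - v) / (z * v) by rewrite /chart; field; rewrite zn vn.
set k := (1 + z + _) * _; have k4 : 1 / 4 <= nm k by rewrite /k modulusM; nra.
have zvn : 0 < nm (z * v) by rewrite modulus_gt0 mulf_neq0.
have -> : nm ((X - (z - v) * Y) / (z * v * k)) = nm (X - (z - v) * Y) / nm k / nm (z * v).
  by rewrite (modulusM (X - _)) modulusV (modulusM (z * v)) [_ * nm k]mulrC invfM mulrA.
have -> : nm ((z - v) / (z * v)) * (4 * D * s ^+ 2) =
    nm (z - v) * (4 * D * s ^+ 2) / nm (z * v).
  by rewrite (modulusM (z - v)) modulusV mulrAC.
rewrite ler_wpM2r ?invr_ge0 ?modulus_ge0//.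
rewrite ler_pdivrMr; last lra.
apply: le_trans hN _.
have : 0 <= nm (z - v) * (s ^+ 2 * D) by rewrite mulr_ge0// mulr_ge0.
nra.
Qed.

End EntryExit.

Section Lavaurs.
Variable R : realType.
Local Notation C := (Cplx R).
Local Notation Re := (@complex.Re R).
Local Notation nm := (@modulus R).

Lemma derivable_bounded_near (h : C -> C) (z0 : C) : derivable h z0 1 ->
  exists2 e : R, 0 < e & forall z, nm (z - z0) < e -> nm (h z) <= nm (h z0) + 1.
Proof.
move=> /derivable1_diffP/differentiable_continuous/cvg_modulusP/(_ 1 ltr01).
move=> /nbhs_modulusP[e e0 he]; exists e => // z /he.
by have := modulus_subr (h z) (h z0); lra.
Qed.

Lemma basin_forward (f : {poly C}) z k : basin f z -> basin f (iter k (horner f) z).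
Proof.
case=> h1 h2; split; last by move=> n; rewrite -iterD.
rewrite (_ : (fun n => iter n (horner f) (iter k (horner f) z)) =
  (fun n => iter (n + k)%N (horner f) z)); last by apply/funext => n; rewrite iterD.
by have := h1; rewrite -(cvg_shiftn k).
Qed.

Lemma fatou_iter (f : {poly C}) (phi : C -> C) :
  (forall z, basin f z -> phi f.[z] = phi z + 1) ->
  forall k z, basin f z -> phi (iter k (horner f) z) = phi z + k%:R.
Proof.
move=> h k z bz; elim: k => [|k ih]; first by rewrite addr0.
by rewrite iterS h ?ih -?addrA ?natr1//; exact: basin_forward.
Qed.

Lemma parameterization_iter (f : {poly C}) (psi : C -> C) :
  (forall Z, psi (Z + 1) = f.[psi Z]) ->
  forall k Z, iter k (horner f) (psi (Z - k%:R)) = psi Z.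
Proof.
move=> h; elim=> [|k ih] Z; first by rewrite /= subr0.
rewrite iterSr -h -[RHS]ih; congr (iter _ _ (psi _)).
by rewrite -(natr1 k); ring.
Qed.

Variable f : {poly C}.
Let b : C := 1 - f`_3.

(** The chart at step K is K + O(log K), so its logarithm is log K + o(1) and the
    normalisation of the Fatou coordinate gives the chart up to o(1). *)
Lemma entry_asymptotics (phi : C -> C) (z0 : C) :
  parabolic f -> is_attracting_fatou_coordinate f phi -> basin f z0 ->
  exists2 d : R, 0 < d & exists B : R,
    (forall z, basin f z -> nm (z - z0) < d -> nm (phi z) <= B) /\
    forall e : R, 0 < e -> \forall K \near \oo, forall z, basin f z -> nm (z - z0) < d ->
      nm (iter K (horner f) z) <= 1 /\
      nm (K%:R ^+ 2 * (iter K (horner f) z + K%:R^-1) - (phi z + b * rC (ln K%:R))) <= e.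
Proof.
move=> hf [hol conj asym] bz0.
have [d1 d10 hB] := derivable_bounded_near (hol z0 bz0).
have [d2 d20 [A [k1 [A0 hA]]]] := basin_asymptotics hf bz0.
exists (Num.min d1 d2); first by rewrite lt_min d10.
exists (nm (phi z0) + 1); split.
  by move=> z _; rewrite lt_min => /andP[/hB].
move=> e e0; have e3 : 0 < e / 3 by rewrite divr_gt0.
have b1 : 0 < nm b + 1 by rewrite ltr_wpDl// modulus_ge0.
have [M hM] := asym _ e3.
have [dl dl0 hl] := logC_near (divr_gt0 e3 b1).
have A1 : 0 <= A + 1 by order_lra.
near=> K => z bz; rewrite lt_min => /andP[_ zd].
have Kk1 : (k1 < K)%N by near: K; exists k1.+1.
have KR : 2 <= K%:R :> R by near: K; exact: nbhs_infty_ger.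
have l0 : 0 <= ln K%:R :> R by rewrite ln_ge0//; order_lra.
have [hRe hm] := hA z zd K Kk1.
set y := iter K (horner f) z in hRe hm *.
have KM : 2 * M + k1%:R + 3 <= K%:R by near: K; exact: nbhs_infty_ger.
have hy : nm (phi y - (chart y - b * logC (chart y))) < e / 3.
  rewrite -modulus_lt; apply: hM; first exact: basin_forward.
  by rewrite -/(chart y); order_lra.
rewrite /y fatou_iter// -/y in hy.
have nK : (K%:R : C) = rC K%:R by rewrite rC_nat.
have KR0 : 0 < K%:R :> R by order_lra.
have h2 : (A + 1) * (1 + ln K%:R) <= dl * K%:R by near: K; exact: near_log.
have h3 : (A + 1) * (1 + ln K%:R) <= 1 / 2 * K%:R by near: K; exact: near_log.
have h4 : 6 * (A + 1) ^+ 2 * (1 + ln K%:R) ^+ 2 <= e * K%:R.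
  by near: K; apply: near_log_sqr => //; rewrite mulr_ge0// sqr_ge0.
set m := (A + 1) * (1 + ln K%:R) in h2 h3.
have m0 : 0 < m by rewrite /m mulr_gt0//; order_lra.
have hm' : nm (chart y - rC K%:R) <= m by rewrite -nK; apply: le_trans hm _; rewrite /m; nra.
have hlog := hl K%:R (chart y) KR0 (le_trans hm' h2).
have nmK : `|K%:R| = K%:R :> R by rewrite normr_nat.
have mK : m <= `|K%:R| / 2 by rewrite nmK; order_lra.
have hdev := chart_dev m0 mK hm'; rewrite nmK in hdev.
have hdev2 : 2 * m ^+ 2 / K%:R <= e / 3.
  by rewrite ler_pdivrMr// /m exprMn; order_lra.
split.
  have : K%:R / 2 <= nm (chart y).
    have := modulus_subr (rC K%:R) (rC K%:R - chart y).
    by rewrite subKr modulus_sym modulus_rC nmK; order_lra.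
  rewrite modulus_chart => h.
  have : 1 <= (nm y)^-1 by order_lra.
  by rewrite invf_ge1//; rewrite -invr_gt0; order_lra.
rewrite nK.
have -> : rC K%:R ^+ 2 * (y + (rC K%:R)^-1) - (phi z + b * rC (ln K%:R)) =
  (rC K%:R ^+ 2 * (y + (rC K%:R)^-1) - (chart y - rC K%:R))
  - (phi z + K%:R - (chart y - b * logC (chart y)))
  + b * (logC (chart y) - rC (ln K%:R)) by rewrite nK; ring.
apply: le_trans (modulusD _ _) _; apply: le_trans (lerD (modulusB _ _) (lexx _)) _.
have : nm (b * (logC (chart y) - rC (ln K%:R))) <= e / 3.
  rewrite modulusM; apply: (@le_trans _ _ ((nm b + 1) * (e / 3 / (nm b + 1)))).
    by apply: ler_pM; rewrite ?modulus_ge0 ?(ltW hlog)//; order_lra.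
  by rewrite mulrC divfK// gt_eqF.
order_lra.
Unshelve. all: by end_near. Qed.

(** K steps before the end, log (K - X) = log K + o(1): the same real logarithm as at
    the entry, which is why the deviations at both ends can be compared. *)
Lemma exit_asymptotics (psi : C -> C) (B : R) :
  is_repelling_fatou_parameterization f psi ->
  forall e : R, 0 < e -> \forall K \near \oo, forall X, nm X <= B ->
    nm (chart (psi (X - K%:R)) - (X - K%:R + b * rC (ln K%:R))) <= e.
Proof.
move=> [_ _ asym] e e0.
have e2 : 0 < e / 2 by rewrite divr_gt0.
have b1 : 0 < nm b + 1 by rewrite ltr_wpDl// modulus_ge0.
have [M hM] := asym _ e2.
have [dl dl0 hl] := logC_near (divr_gt0 e2 b1).
near=> K => X XB.
have KR : 1 <= K%:R :> R by near: K; exact: nbhs_infty_ger.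
have KR0 : 0 < K%:R :> R by order_lra.
have KM : B - M + 1 <= K%:R by near: K; exact: nbhs_infty_ger.
have Kd : B / dl <= K%:R by near: K; exact: nbhs_infty_ger.
have hl1 : nm (logC (- (X - K%:R)) - rC (ln K%:R)) < e / 2 / (nm b + 1).
  apply: hl => //; rewrite -rC_nat opprB addrAC subrr add0r modulusN.
  by rewrite ler_pdivrMr// mulrC in Kd; order_lra.
have /hM : Re (X - K%:R) < M.
  rewrite ReD ReN -rC_nat Re_rC; have := modulus_ge_Re X; rewrite ler_norml; order_lra.
rewrite modulus_lt => h.
have -> : chart (psi (X - K%:R)) - (X - K%:R + b * rC (ln K%:R)) =
  (- (psi (X - K%:R))^-1 - (X - K%:R + b * logC (- (X - K%:R))))
  + b * (logC (- (X - K%:R)) - rC (ln K%:R)) by rewrite /chart; ring.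
apply: le_trans (modulusD _ _) _.
have : nm (b * (logC (- (X - K%:R)) - rC (ln K%:R))) <= e / 2.
  rewrite modulusM; apply: (@le_trans _ _ ((nm b + 1) * (e / 2 / (nm b + 1)))).
    by apply: ler_pM; rewrite ?modulus_ge0 ?(ltW hl1)//; order_lra.
  by rewrite mulrC divfK// gt_eqF.
rewrite /b in h *; order_lra.
Unshelve. all: by end_near. Qed.

(** The last K steps are uniformly Lipschitz from the chart, whatever K is: the
    distortion factors have a bounded product, and the last K0 steps, K0 being fixed,
    are those of a fixed polynomial map. *)
Lemma exit_stability (psi : C -> C) (B : R) :
  is_repelling_fatou_parameterization f psi ->
  (exists q : {poly C}, forall z, f.[z] = z + z ^+ 2 + z ^+ 3 * q.[z]) ->
  exists A : R, exists2 d0 : R, 0 <= A /\ 0 < d0 & \forall K \near \oo,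
    forall X z (d : R), nm X <= B -> z != 0 -> d <= d0 ->
      nm (chart z - chart (psi (X - K%:R))) <= d ->
      nm (iter K (horner f) z - psi X) <= A * d.
Proof.
move=> hpsi [q fE]; have [A [r [A0 r0] hdist]] := chart_distortion fE.
(* at step i from the end, points of size 2/i give a factor 1 + A (4/i)^2 *)
pose D := 16 * A.
have D0 : 0 <= D by rewrite /D mulr_ge0.
have Bb : 0 <= `|B| + nm b + 1 by rewrite !addr_ge0// modulus_ge0.
have [K0 _ hK0] : \forall i \near \oo,
    [/\ 4 <= i%:R :> R, 2 / r <= i%:R & forall X, nm X <= B ->
     nm (chart (psi (X - i%:R)) + i%:R) <= i%:R / 4].
  near=> i; split; [near: i; exact: nbhs_infty_ger|near: i; exact: nbhs_infty_ger|].
  have h1 : (`|B| + nm b + 1) * (1 + ln i%:R) <= 1 / 4 * i%:R by near: i; exact: near_log.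
  have h2 : forall X, nm X <= B ->
    nm (chart (psi (X - i%:R)) - (X - i%:R + b * rC (ln i%:R))) <= 1.
    by near: i; apply: exit_asymptotics.
  have i1 : 1 <= i%:R :> R by near: i; exact: nbhs_infty_ger.
  have l0 : 0 <= ln i%:R :> R by rewrite ln_ge0.
  move=> X XB; have -> : chart (psi (X - i%:R)) + i%:R =
    (chart (psi (X - i%:R)) - (X - i%:R + b * rC (ln i%:R))) + (X + b * rC (ln i%:R)) by ring.
  apply: le_trans (modulusD _ _) _; have := h2 X XB.
  have := modulusD X (b * rC (ln i%:R)); rewrite (modulusM b) modulus_rC ger0_norm//.
  have := ler_norm B; have := modulus_ge0 b.
  have : 0 <= `|B| * ln i%:R by rewrite mulr_ge0.
  order_lra.
pose E := expR D.
have E0 : 0 < E by exact: expR_gt0.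
have En : E != 0 by rewrite gt_eqF.
have [L [M L0 hL]] := poly_iter_lipschitz f 1 K0.
exists (L * E), E^-1; first by rewrite invr_gt0 mulr_ge0// ltW.
near=> K; have K0K : (K0 <= K)%N by near: K; exists K0.
move=> X z d XB zn dE hd.
have d0 : 0 <= d by apply: le_trans hd; exact: modulus_ge0.
have bounds i u : (K0 <= i)%N -> u != 0 ->
    nm (chart u - chart (psi (X - i%:R))) <= d * expR (D / i%:R) ->
    [/\ 0 < nm u, nm u <= 2 / i%:R, 0 < nm (psi (X - i%:R)) & nm (psi (X - i%:R)) <= 2 / i%:R].
  move=> K0i un hu; have [i4 ir hV] := hK0 i K0i; have {}hV := hV X XB.
  have i0 : 0 < i%:R :> R by order_lra.
  have hE : d * expR (D / i%:R) <= 1.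
    apply: (@le_trans _ _ (d * E)).
      by rewrite ler_wpM2l// ler_expR ler_pdivrMr// ler_peMr//; order_lra.
    by rewrite -(mulVf En) ler_wpM2r// ltW.
  set V := chart (psi _) in hu hV.
  have V2 : i%:R * 3 / 4 <= nm V.
    have := modulus_subr (i%:R : C) (V + i%:R).
    rewrite modulus_sym addrK -{1}rC_nat modulus_rC normr_nat; order_lra.
  have V1 : i%:R / 2 <= nm V by order_lra.
  have U1 : i%:R / 2 <= nm (chart u).
    by have := modulus_subr V (V - chart u); rewrite subKr modulus_sym; order_lra.
  have inv_le y : i%:R / 2 <= nm (chart y) -> 0 < nm y /\ nm y <= 2 / i%:R.
    rewrite modulus_chart => hy.
    have y0 : 0 < nm y by rewrite -invr_gt0; order_lra.
    split=> //; rewrite -[leLHS]invrK -[2 / _]invf_div lef_pV2 ?posrE ?invr_gt0//.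
    by rewrite divr_gt0.
  by have [? ?] := inv_le u U1; have [? ?] := inv_le _ V1.
(* the product of the factors telescopes since 1/i^2 <= 1/(i-1) - 1/i *)
have claim m : (m <= K - K0)%N -> iter m (horner f) z != 0 /\
    nm (chart (iter m (horner f) z) - chart (psi (X - (K - m)%:R))) <=
    d * expR (D / (K - m)%:R).
  elim: m => [_|m ih mK].
    split=> //; rewrite subn0 /=; apply: le_trans hd _.
    by rewrite ler_peMr// -expR0 ler_expR divr_ge0.
  have [un hu] := ih (ltnW mK); rewrite iterS; move: un hu.
  have K0i : (K0 <= K - m)%N by nat_lia.
  have iS : ((K - m.+1).+1 = K - m)%N by nat_lia.
  set u := iter m _ z; set i := (K - m)%N in K0i iS *; set j := (K - m.+1)%N in iS *.
  move=> un hu; have [u0 u2 v0 v2] := bounds i u K0i un hu.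
  have [i4 ir _] := hK0 i K0i; have i0 : 0 < i%:R :> R by order_lra.
  have ir' : 2 / i%:R <= r by rewrite ler_pdivrMr// mulrC -ler_pdivrMr.
  have vS : psi (X - j%:R) = f.[psi (X - i%:R)].
    by case: hpsi => _ <- _; rewrite -iS -natr1; congr psi; ring.
  have hu' : 0 < nm u <= r by rewrite u0 (le_trans u2).
  have hv' : 0 < nm (psi (X - i%:R)) <= r by rewrite v0 (le_trans v2).
  have [fu _ h] := hdist _ _ hu' hv'; split=> //; rewrite vS; apply: le_trans h _.
  apply: (@le_trans _ _ (d * expR (D / i%:R) * expR (D / i%:R ^+ 2))).
    apply: ler_pM => //; first exact: modulus_ge0.
      by rewrite addr_ge0// mulr_ge0// sqr_ge0.
    apply: le_trans (expR_ge1Dx _); rewrite lerD2l.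
    have -> : D / i%:R ^+ 2 = A * (4 / i%:R) ^+ 2 by rewrite /D; field; rewrite gt_eqF.
    rewrite ler_wpM2l// lerXn2r ?nnegrE ?addr_ge0 ?modulus_ge0 ?divr_ge0//; order_lra.
  rewrite -mulrA -expRD ler_wpM2l// ler_expR.
  have iE : i%:R = j%:R + 1 :> R by rewrite -iS natr1.
  have j0 : 0 < j%:R :> R by order_lra.
  have -> : D / j%:R = D / i%:R + D / (i%:R * j%:R).
    by rewrite iE; field; rewrite !gt_eqF//; order_lra.
  rewrite lerD2l ler_wpM2l// lef_pV2 ?posrE ?mulr_gt0 ?exprn_gt0//.
  by rewrite expr2 ler_wpM2l ?(ltW i0)//; order_lra.
have [un hu] := claim _ (leqnn _); rewrite subKn// in hu.
have [u0 u2 v0 v2] := bounds K0 _ (leqnn _) un hu.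
have [i4 _ _] := hK0 K0 (leqnn _); have i0 : 0 < K0%:R :> R by order_lra.
have i2 : 2 / K0%:R <= 1 :> R by rewrite ler_pdivrMr// mul1r; order_lra.
have psiS : forall Z, psi (Z + 1) = f.[psi Z] by case: hpsi.
rewrite -(subnKC K0K) iterD -(parameterization_iter psiS K0 X).
move: un hu u0 u2 v0 v2; set u := iter _ _ z; set v := psi _ => un hu u0 u2 v0 v2.
have [_ +] := hL u v (le_trans u2 i2) (le_trans v2 i2).
move=> /le_trans; apply; rewrite -mulrA ler_wpM2l//.
have vn : v != 0 by rewrite -modulus_gt0.
have -> : u - v = (chart u - chart v) * (u * v) by rewrite /chart; field; rewrite un vn.
rewrite modulusM (modulusM u) mulrC.
apply: (@le_trans _ _ (1 * (d * expR (D / K0%:R)))).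
  apply: ler_pM => //; rewrite ?mulr_ge0 ?modulus_ge0//.
  by rewrite mulr_ile1 ?modulus_ge0//; order_lra.
rewrite mul1r [leRHS]mulrC ler_wpM2l// ler_expR ler_pdivrMr// ler_peMr//; order_lra.
Unshelve. all: by end_near. Qed.

End Lavaurs.

(** * Convergence to the Lavaurs map *)

Section LavaursLimit.
Variable R : realType.
Local Notation C := (Cplx R).
Local Notation nm := (@modulus R).

Lemma cubic_remainder (f : {poly C}) :
  (fun z => f.[z]) = (fun z : C => z + z ^+ 2) +O_ (0 : C) (fun z => z ^+ 3) ->
  (exists k : {poly C}, forall z, f.[z] = z + z ^+ 2 + f`_3 * z ^+ 3 + z ^+ 4 * k.[z]) /\
  (exists q : {poly C}, forall z, f.[z] = z + z ^+ 2 + z ^+ 3 * q.[z]) /\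
  parabolic f.
Proof.
move=> hf; have [k fE] := parabolic_expansion hf.
pose q := (f`_3)%:P + 'X * k.
have qE z : f.[z] = z + z ^+ 2 + z ^+ 3 * q.[z].
  by rewrite fE /q hornerD hornerM hornerC hornerX; ring.
split; [by exists k|split; first by exists q].
have [Q Q0 hQ] := poly_bounded q 1; exists Q => // z z1.
have -> : f.[z] - (z + z ^+ 2) = q.[z] * z ^+ 3 by rewrite qE; ring.
by rewrite modulusM modulusX ler_wpM2r ?exprn_ge0 ?modulus_ge0// hQ.
Qed.

(** Conjugating by w |-> - w reduces the germ w - w^2 + O(w^3) to z + z^2 + O(z^3), and
    turns the chart into the inverse. *)
Lemma basin_inverse (g : {poly C}) (w0 : C) :
  (fun w => g.[w]) = (fun w : C => w - w ^+ 2) +O_ (0 : C) (fun w => w ^+ 3) ->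
  basin g w0 -> exists2 d : R, 0 < d & exists2 A : R, 0 <= A &
    \forall m \near \oo, forall w, nm (w - w0) < d ->
      nm ((iter m (horner g) w)^-1 - m%:R) <= A * (1 + ln m%:R) /\
      nm (iter m (horner g) w) <= 2 / m%:R.
Proof.
move=> hg bw; pose h : {poly C} := - (g \Po (- 'X)).
have hE y : h.[y] = - g.[- y] by rewrite /h hornerN horner_comp hornerN hornerX.
have hi k w : iter k (horner h) (- w) = - iter k (horner g) w.
  by elim: k => // k ih; rewrite !iterS ih hE opprK.
have hp : parabolic h.
  have gc : forall i, (i < 3)%N -> g`_i = ('X - 'X^2 : {poly C})`_i.
    by apply: germ_coef; under [in RHS]eq_fun do rewrite hornerD hornerN hornerX hornerXn.
  pose q := drop_poly 3 g.
  have gE w : g.[w] = w - w ^+ 2 + q.[w] * w ^+ 3.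
    rewrite {1}(poly_split g 3) !big_ord_recl big_ord0 /= /bump /= !add1n.
    rewrite (gc 0%N)// (gc 1%N)// (gc 2%N)// !coefB !coefX !coefXn /=.
    by rewrite !hornerE /=; ring.
  have [Q Q0 hQ] := poly_bounded q 1; exists Q => // z z1.
  have -> : h.[z] - (z + z ^+ 2) = q.[- z] * z ^+ 3 by rewrite hE gE; ring.
  by rewrite modulusM modulusX ler_wpM2r ?exprn_ge0 ?modulus_ge0// hQ// modulusN.
have bh : basin h (- w0).
  case: bw => b1 b2; split; last by move=> n; rewrite hi oppr_eq0.
  apply/cvg_modulusP => e e0; move/cvg_modulusP/(_ e e0): b1.
  by apply: filterS => n; rewrite !subr0 hi modulusN.
have [d d0 [A [k1 [A0 hA]]]] := basin_asymptotics hp bh.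
exists d => //; exists A => //; near=> m => w wd.
have k1m : (k1 < m)%N by near: m; exists k1.+1.
have m1 : 1 <= m%:R :> R by near: m; exact: nbhs_infty_ger.
have hd : nm (- w - - w0) < d by rewrite -opprD modulusN.
have [_] := hA _ hd m k1m; rewrite hi /chart invrN opprK => hm; split=> //.
have hl : A * (1 + ln m%:R) <= 1 / 2 * m%:R by near: m; exact: near_log.
have : m%:R / 2 <= nm (iter m (horner g) w)^-1.
  have := modulus_subr (m%:R : C) (m%:R - (iter m (horner g) w)^-1).
  by rewrite subKr modulus_sym -{1}rC_nat modulus_rC normr_nat; lra.
rewrite modulusV => h1.
have i0 : 0 < (nm (iter m (horner g) w))^-1 by lra.
rewrite -[leLHS]invrK -[2 / _]invf_div lef_pV2 ?posrE//.
by rewrite divr_gt0//; lra.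
Unshelve. all: by end_near. Qed.

Lemma skew_map_iter (f g : {poly C}) (z w : C) (j : nat) :
  (iter j.+1 (skew_map f g) (z, w)).1 =
    f.[(iter j (skew_map f g) (z, w)).1] + rC (pi ^+ 2 / 4) * iter j (horner g) w /\
  (iter j (skew_map f g) (z, w)).2 = iter j (horner g) w.
Proof.
have h i : (iter i (skew_map f g) (z, w)).2 = iter i (horner g) w.
  by elim: i => // i ih; rewrite !iterS /skew_map /= ih.
by split=> //; rewrite iterS [LHS]/= h.
Qed.

Lemma gate_dev_end n (z : C) K : (K <= 2 * n + 1)%N ->
  gate_dev n z (2 * n + 1 - K) = - gate_dev n (- z) K.
Proof.
by move=> KN; rewrite /gate_dev; have [-> ->] := gate_symmetry R KN; rewrite rCN; ring.
Qed.

Lemma gate_dev_modulus n K (z : C) : (2 <= n)%N -> (18 <= K <= n)%N ->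
  nm (gate_dev n z K) <= K%:R / 2 -> nm z <= 3.
Proof.
move=> n2 /andP[K18 Kn] hz; have KR : 18 <= K%:R :> R by rewrite (ler_nat _ 18).
have wK := gate_width_ge R n2 Kn; set w := gate_width R n K in wK.
have w3 : 3 <= w by lra.
have w0 : 0 < w by lra.
have zw : nm (rC (gate_orbit R n K)) <= 1.
  rewrite modulus_rC; apply: le_trans (gate_orbit_le w0) _.
  by rewrite -/w invf_le1//; lra.
have wn : rC w != 0 by rewrite rC_eq0 gt_eqF.
have -> : z = rC (gate_orbit R n K) + gate_dev n z K / rC w ^+ 2.
  by rewrite /gate_dev -/w mulrAC mulfV ?expf_neq0// mul1r subrKC.
apply: le_trans (modulusD _ _) _; rewrite modulusM modulusV modulusX (modulus_rC w) gtr0_norm//.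
have : nm (gate_dev n z K) / w ^+ 2 <= 1.
  have ww : 3 * w <= w * w by rewrite ler_wpM2r// ltW.
  by rewrite ler_pdivrMr ?exprn_gt0// mul1r expr2; lra.
lra.
Qed.

(** K steps before the end, a deviation close to X + b log K means a chart close to the
    one of psi (X - K), and the remaining steps preserve this proximity. *)
Lemma gate_exit (f : {poly C}) (psi : C -> C) (B e : R) :
  (fun z => f.[z]) = (fun z : C => z + z ^+ 2) +O_ (0 : C) (fun z => z ^+ 3) ->
  is_repelling_fatou_parameterization f psi ->
  0 < e -> exists2 d : R, 0 < d & \forall K \near \oo,
  \forall n \near \oo, forall X (z : C), nm X <= B ->
    nm (gate_dev n z (2 * n + 1 - K) - (X + (1 - f`_3) * rC (ln K%:R))) <= d ->
    nm z <= 1 /\ nm (iter K (horner f) z - psi X) <= e.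
Proof.
set b := 1 - f`_3.
move=> hf hpsi e0; have [_ [fq fp]] := cubic_remainder hf.
have [A [d0 [A0 d00] hexit]] := exit_stability B hpsi fq.
(* the charts of z and psi (X - K) will differ by 4 d at most *)
pose d := Num.min (Num.min 1 (d0 / 4)) (e / (4 * (A + 1))).
have dd : 0 < d by rewrite !lt_min ltr01 !divr_gt0//; order_lra.
have [d1 d4 de] : [/\ d <= 1, d <= d0 / 4 & A * (4 * d) <= e].
  have : d <= e / (4 * (A + 1)) by rewrite /d ge_min lexx orbT.
  rewrite ler_pdivlMr => [h|]; last order_lra.
  by split; [rewrite /d !ge_min lexx|rewrite /d !ge_min lexx orbT|nra].
have nb := modulus_ge0 b.
pose c := `|B| + nm b + 2.
have c0 : 2 <= c by rewrite /c; have := normr_ge0 B; order_lra.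
exists d => //; near=> K.
have K18 : (18 <= K)%N by near: K; exists 18%N.
have K0 : (0 < K)%N by apply: leq_trans K18.
have KR : 18 <= K%:R :> R by rewrite (ler_nat _ 18).
have l0 : 0 <= ln K%:R :> R by rewrite ln_ge0//; order_lra.
have hm1 : c * (1 + ln K%:R) <= 1 / 4 * K%:R by near: K; apply: near_log => //; order_lra.
have hm2 : 2 * c ^+ 2 * (1 + ln K%:R) ^+ 2 <= d * K%:R.
  by near: K; apply: near_log_sqr => //; rewrite mulr_ge0// sqr_ge0.
have hV : forall X, nm X <= B ->
    nm (chart (psi (X - K%:R)) - (X - K%:R + b * rC (ln K%:R))) <= d.
  by near: K; apply: exit_asymptotics.
have hS : forall X z (d : R), nm X <= B -> z != 0 -> d <= d0 ->
      nm (chart z - chart (psi (X - K%:R))) <= d ->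
      nm (iter K (horner f) z - psi X) <= A * d by near: K.
near=> n => X z XB hz.
have Kn : (K < n)%N by near: n; exists K.+1.
have hn : forall y, nm y <= 3 -> nm (gate_dev n y K - K%:R ^+ 2 * (y + K%:R^-1)) <= d.
  by near: n; apply: gate_dev_cvg.
set m := c * (1 + ln K%:R) in hm1.
have m0 : 0 < m by rewrite /m mulr_gt0//; order_lra.
have hX : nm (X + b * rC (ln K%:R)) <= m - 2.
  apply: le_trans (modulusD _ _) _; rewrite (modulusM b) modulus_rC ger0_norm// /m /c.
  have h3 : 0 <= `|B| * ln K%:R by rewrite mulr_ge0.
  by have := ler_norm B; order_lra.
have hE : nm (gate_dev n (- z) K) <= K%:R / 2.
  move: hz; rewrite gate_dev_end; last by nat_lia.
  set E := gate_dev _ _ _ => hz.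
  have := modulusD (- E - (X + b * rC (ln K%:R))) (X + b * rC (ln K%:R)).
  by rewrite subrK modulusN; order_lra.
have z3 : nm (- z) <= 3 by apply: gate_dev_modulus hE; rewrite ?K18 //=; nat_lia.
have hdev := hn _ z3.
have nK : (K%:R : C) = rC K%:R by rewrite rC_nat.
(* the deviation from 1/K, which is - 1/p for p = - K *)
pose E := rC (- K%:R) ^+ 2 * (z + (rC (- K%:R))^-1).
have EX : nm (E - (X + b * rC (ln K%:R))) <= 2 * d.
  have -> : E - (X + b * rC (ln K%:R)) =
    (gate_dev n (- z) K - K%:R ^+ 2 * (- z + K%:R^-1)) +
    (gate_dev n z (2 * n + 1 - K) - (X + b * rC (ln K%:R))).
    rewrite gate_dev_end; last by nat_lia.
    by rewrite /E nK rCN invrN; ring.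
  by apply: le_trans (modulusD _ _) _; order_lra.
have Em : nm E <= m.
  by have := modulusD (E - (X + b * rC (ln K%:R))) (X + b * rC (ln K%:R)); rewrite subrK; order_lra.
have nmK : `|- K%:R| = K%:R :> R by rewrite normrN normr_nat.
have mK : m <= `|- K%:R| / 2 by rewrite nmK; order_lra.
have [zn hU] := dev_chart m0 mK Em; rewrite -/E nmK in hU.
have hm3 : 2 * m ^+ 2 / K%:R <= d.
  by rewrite ler_pdivrMr ?ltr0n// /m exprMn; order_lra.
split.
  have h1 : nm (chart z + K%:R) <= m + d.
    have -> : chart z + K%:R = (chart z - rC (- K%:R) - E) + E by rewrite nK rCN; ring.
    by apply: le_trans (modulusD _ _) _; order_lra.
  have := modulus_subr (K%:R : C) (chart z + K%:R).
  rewrite modulus_sym addrK -{1}rC_nat modulus_rC normr_nat modulus_chart => h2.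
  have : 1 <= (nm z)^-1 by order_lra.
  by rewrite invf_ge1// modulus_gt0.
apply: (le_trans _ de); apply: hS => //; first order_lra.
have -> : chart z - chart (psi (X - K%:R)) =
  (chart z - rC (- K%:R) - E) + (E - (X + b * rC (ln K%:R)))
  - (chart (psi (X - K%:R)) - (X - K%:R + b * rC (ln K%:R))) by rewrite nK rCN; ring.
apply: le_trans (modulusB _ _) _; apply: le_trans (lerD (modulusD _ _) (lexx _)) _.
by have := hV X XB; order_lra.
Unshelve. all: by end_near. Qed.

End LavaursLimit.

Local Notation nm := (@modulus _).

(** First K is chosen, then n: the K first and the K last steps are those of a fixed
    number of iterations of f slightly perturbed, while the passage between them
    contributes an error which is small when K is large, uniformly in n. *)
Lemma uniform_passage (R : realType) (f g : {poly Cplx R}) (phi psi : Cplx R -> Cplx R)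
  (z0 w0 : Cplx R) :
  (fun z => f.[z]) =
    (fun z : Cplx R => z + z ^+ 2) +O_ (0 : Cplx R) (fun z => z ^+ 3) ->
  (fun w => g.[w]) =
    (fun w : Cplx R => w - w ^+ 2) +O_ (0 : Cplx R) (fun w => w ^+ 3) ->
  is_attracting_fatou_coordinate f phi ->
  is_repelling_fatou_parameterization f psi ->
  basin f z0 -> basin g w0 ->
  exists2 d : R, 0 < d & forall e : R, 0 < e -> \forall n \near \oo,
    forall z w, basin f z -> nm (z - z0) < d -> nm (w - w0) < d ->
      nm ((iter (2 * n + 1) (skew_map f g) (z, iter (n ^ 2) (horner g) w)).1
          - psi (phi z)) <= e /\
      nm (iter (2 * n + 1) (skew_map f g) (z, iter (n ^ 2) (horner g) w)).2 <= e.
Proof.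
pose C := Cplx R; pose b : C := 1 - f`_3.
move=> hf hg hphi hpsi bz0 bw0; have [[k fE'] [_ fp]] := cubic_remainder hf.
have fE y : f.[y] = y + y ^+ 2 + (1 - b) * y ^+ 3 + y ^+ 4 * k.[y] by rewrite subKr fE'.
have [d1 d10 [B [hB hentry]]] := entry_asymptotics fp hphi bz0.
have [d2 d20 [A2 A20 [n1 _ hw]]] := basin_inverse hg bw0.
exists (Num.min d1 d2); first by rewrite lt_min d10.
move=> e e0; have e2 : 0 < e / 2 by rewrite divr_gt0.
have [B' B'0 [n0 hforce]] := forcing_le A20.
have [A A0 [K2 hgate]] := gate_passage (B + 1) fE (ler0n R 162).
have [d dd hexit] := gate_exit B hf hpsi e2.
pose d' := Num.min d 1.
have d'0 : 0 < d' by rewrite lt_min dd ltr01.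
have [d'd d'1] : d' <= d /\ d' <= 1 by rewrite !ge_min !lexx orbT.
have d8 : 0 < d' / 8 by rewrite divr_gt0.
near (\oo : set_system nat) => K.
have K1 : (0 < K)%N by near: K; exists 1%N.
have KK2 : (K2 <= K)%N by near: K; exists K2.
have KR : 1 <= K%:R :> R by rewrite ler1n.
have hAK : A <= d' / 8 * Num.sqrt K%:R by near: K; apply: near_sqrt_ge.
have hin : forall z, basin f z -> nm (z - z0) < d1 ->
      nm (iter K (horner f) z) <= 1 /\
      nm (K%:R ^+ 2 * (iter K (horner f) z + K%:R^-1) - (phi z + b * rC (ln K%:R))) <= d' / 8.
  by near: K; apply: hentry.
have hout : \forall n \near \oo, forall X (z : C), nm X <= B ->
    nm (gate_dev n z (2 * n + 1 - K) - (X + b * rC (ln K%:R))) <= d ->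
    nm z <= 1 /\ nm (iter K (horner f) z - psi X) <= e / 2 by near: K.
have K20 : 0 < K%:R ^+ 2 :> R by rewrite exprn_gt0//; order_lra.
have e8 : 0 < Num.min 1 (d' / 8 / K%:R ^+ 2) by rewrite lt_min ltr01 divr_gt0.
have [t1 t10 hpert1] := iter_perturbation f K (nm z0 + d1) e8.
have [t2 t20 hpert2] := iter_perturbation f K 1 e2.
near=> n => z w bz; rewrite !lt_min => /andP[zd _] /andP[_ wd].
have n2 : (2 <= n)%N by near: n; exists 2%N.
have Kn : (K.+1 < n)%N by near: n; exists K.+2.
have nn0 : (n0 <= n)%N by near: n; exists n0.
have nn1 : (n1 <= n)%N by near: n; exists n1.
have nR : 2 <= n%:R :> R by rewrite (ler_nat _ 2).
have nt1 : 8 / t1 <= n%:R by near: n; exact: nbhs_infty_ger.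
have nt2 : 8 / t2 <= n%:R by near: n; exact: nbhs_infty_ger.
have ne : 2 / e <= n%:R by near: n; exact: nbhs_infty_ger.
have hdev : forall y, nm y <= 2 ->
    nm (gate_dev n y K - K%:R ^+ 2 * (y + K%:R^-1)) <= d' / 8.
  by near: n; apply: gate_dev_cvg.
have hX := hB z bz zd.
have hexitn : forall X (z : C), nm X <= B ->
    nm (gate_dev n z (2 * n + 1 - K) - (X + b * rC (ln K%:R))) <= d ->
    nm z <= 1 /\ nm (iter K (horner f) z - psi X) <= e / 2 by near: n.
have hBn : 27 * B' * Num.sqrt K%:R <= 1 * Num.sqrt n%:R.
  by near: n; apply: near_sqrt_ge; rewrite // !mulr_ge0 ?sqrtr_ge0.
pose Z j := (iter j (skew_map f g) (z, iter (n ^ 2) (horner g) w)).1.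
pose c j := rC (pi ^+ 2 / 4) * iter (n ^ 2 + j) (horner g) w.
have wE j : iter j (horner g) (iter (n ^ 2) (horner g) w) = iter (n ^ 2 + j) (horner g) w.
  by rewrite addnC iterD.
have ZS j : Z j.+1 = f.[Z j] + c j.
  by rewrite /Z /c -wE; case: (skew_map_iter f g z (iter (n ^ 2) (horner g) w) j).
have nm2 j : (n <= n ^ 2 + j)%N by rewrite (leq_trans _ (leq_addr _ _))// -mulnn leq_pmulr//; nat_lia.
have wj j : nm ((iter (n ^ 2 + j) (horner g) w)^-1 - (n ^ 2 + j)%:R) <=
      A2 * (1 + ln (n ^ 2 + j)%:R) /\ nm (iter (n ^ 2 + j) (horner g) w) <= 2 / n%:R.
  have [h1 h2] := hw (n ^ 2 + j)%N (leq_trans nn1 (nm2 j)) w wd; split=> //.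
  apply: le_trans h2 _; rewrite ler_wpM2l// lef_pV2 ?posrE ?ltr0n ?ler_nat//.
    by apply: leq_trans (nm2 j); nat_lia.
  by nat_lia.
have n0R : 0 < n%:R :> R by order_lra.
have p4 : nm (rC (pi ^+ 2 / 4)) <= 4 :> R.
  have p16 := pi_sqr_lt16 R; have p0 := sqr_ge0 (pi : R).
  by rewrite modulus_rC ger0_norm; order_lra.
have c8 j : nm (c j) <= 8 / n%:R.
  rewrite /c modulusM; have [_ h] := wj j.
  have -> : 8 / n%:R = 4 * (2 / n%:R) :> R by ring.
  by apply: ler_pM; rewrite ?modulus_ge0.
have ct1 j : nm (c j) <= t1.
  by apply: le_trans (c8 j) _; rewrite ler_pdivrMr// mulrC -ler_pdivrMr.
have ct2 j : nm (c j) <= t2.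
  by apply: le_trans (c8 j) _; rewrite ler_pdivrMr// mulrC -ler_pdivrMr.
rewrite -/(Z _) (skew_map_iter f g z _ _).2 wE; split; last first.
  by have [_ h] := wj (2 * n + 1)%N; apply: le_trans h _; rewrite ler_pdivrMr// mulrC -ler_pdivrMr.
(* for n large the first K steps follow f, so the deviation at step K is given by phi *)
have zB : nm (Z 0%N) <= nm z0 + d1.
  by rewrite /Z /=; have := modulus_subr z z0; order_lra.
have := hpert1 Z c zB (fun j _ => conj (ZS j) (ct1 j)); rewrite [Z 0%N]/= le_min => /andP[hK1 hKd].
have [hy1 hyE] := hin z bz zd.
set y := iter K (horner f) z in hK1 hKd hy1 hyE.
have ZK2 : nm (Z K) <= 2 by have := modulus_subr (Z K) y; order_lra.
have hEK : nm (gate_dev n (Z K) K - (phi z + b * rC (ln K%:R))) <= 3 * (d' / 8).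
  have -> : gate_dev n (Z K) K - (phi z + b * rC (ln K%:R)) =
    (gate_dev n (Z K) K - K%:R ^+ 2 * (Z K + K%:R^-1)) + K%:R ^+ 2 * (Z K - y)
    + (K%:R ^+ 2 * (y + K%:R^-1) - (phi z + b * rC (ln K%:R))) by ring.
  apply: le_trans (modulusD _ _) _; apply: le_trans (lerD (modulusD _ _) (lexx _)) _.
  have h1 : nm (K%:R ^+ 2 * (Z K - y)) <= d' / 8.
    rewrite modulusM modulusX -{1}rC_nat modulus_rC normr_nat.
    by rewrite mulrC -ler_pdivlMr.
  by have := hdev _ ZK2; order_lra.
(* the hypotheses of the passage, with the error th of order n^(-7/2) on the forcing *)
have hB1 : nm (gate_dev n (Z K) K - b * rC (ln K%:R)) <= B + 1.
  have := modulusD (gate_dev n (Z K) K - (phi z + b * rC (ln K%:R))) (phi z).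
  have -> : gate_dev n (Z K) K - (phi z + b * rC (ln K%:R)) + phi z =
    gate_dev n (Z K) K - b * rC (ln K%:R) by ring.
  order_lra.
pose th := B' / (n%:R ^+ 3 * Num.sqrt n%:R).
have sn0 : 0 < Num.sqrt n%:R :> R by rewrite sqrtr_gt0.
have n30 : 0 < n%:R ^+ 3 :> R by rewrite exprn_gt0.
have hth : th * (2 * n + 1)%:R ^+ 3 * Num.sqrt K%:R <= 1.
  rewrite /th mulrAC -mulrA mulrAC ler_pdivrMr ?mulr_gt0// mul1r.
  have h3 : (2 * n + 1)%:R ^+ 3 <= 27 * n%:R ^+ 3 :> R.
    have -> : 27 * n%:R ^+ 3 = (3 * n%:R) ^+ 3 :> R by ring.
    by rewrite lerXn2r ?nnegrE ?mulr_ge0// natrD natrM; order_lra.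
  apply: (@le_trans _ _ (n%:R ^+ 3 * (27 * B' * Num.sqrt K%:R))).
    have sK : 0 <= B' * Num.sqrt K%:R by rewrite mulr_ge0// sqrtr_ge0.
    have : (B' * Num.sqrt K%:R) * (2 * n + 1)%:R ^+ 3 <=
      (B' * Num.sqrt K%:R) * (27 * n%:R ^+ 3) by rewrite ler_wpM2l.
    order_lra.
  by rewrite ler_wpM2l ?(ltW n30)//; order_lra.
have ka0 : 0 <= gate_slope R n by rewrite /gate_slope divr_ge0 ?sqr_ge0// mulr_ge0// exprn_ge0.
have n1' : (1 <= n)%N by nat_lia.
have hstep j : (K <= j)%N -> (j < 2 * n + 1 - K)%N ->
    Z j.+1 = f.[Z j] + c j /\
    nm (c j - rC (gate_tan R n ^+ 2) - rC (gate_slope R n * ((2 * n + 1)%:R - 2 * j%:R))) <= th.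
  move=> Kj jK; split; first exact: ZS.
  apply: hforce => //; first by nat_lia.
  by have [] := wj j.
have hpass := hgate K n (gate_slope R n) th Z c KK2 Kn ka0 (gate_slope_le R n1') hth hstep hB1.
have hAd : A / Num.sqrt K%:R <= d' / 8 by rewrite ler_pdivrMr// sqrtr_gt0; order_lra.
(* the last K steps follow f again, from a point close to psi (phi z - K) *)
set N := (2 * n + 1)%N in hpass hexitn *.
have hEN : nm (gate_dev n (Z (N - K)%N) (N - K) - (phi z + b * rC (ln K%:R))) <= d.
  have := modulusD (gate_dev n (Z (N - K)%N) (N - K) - gate_dev n (Z K) K)
    (gate_dev n (Z K) K - (phi z + b * rC (ln K%:R))).
  rewrite addrA subrK; order_lra.
have [zN hfin] := hexitn _ _ hX hEN.
have KN : (K <= N)%N by nat_lia.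
have := hpert2 (fun i => Z (N - K + i)%N) (fun i => c (N - K + i)%N).
rewrite /= addn0 subnK// => /(_ zN) h.
have := h (fun j _ => conj _ (ct2 _)).
have hS : forall j, Z (N - K + j.+1)%N = f.[Z (N - K + j)%N] + c (N - K + j)%N.
  by move=> j; rewrite addnS ZS.
move=> /(_ (fun j => hS j)) h'.
have := modulus_tri (iter K (horner f) (Z (N - K)%N)) (Z N) (psi (phi z)).
order_lra.
Unshelve. all: by end_near. Qed.

Theorem proposition1 (R : realType) (f g : {poly Cplx R})
  (hf : (fun z => f.[z]) =
        (fun z : Cplx R => z + z ^+ 2) +O_ (0 : Cplx R) (fun z => z ^+ 3))
  (hg : (fun w => g.[w]) =
        (fun w : Cplx R => w - w ^+ 2) +O_ (0 : Cplx R) (fun w => w ^+ 3))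
  (phi psi : Cplx R -> Cplx R)
  (hphi : is_attracting_fatou_coordinate f phi)
  (hpsi : is_repelling_fatou_parameterization f psi) :
  locally_uniform_cvg (basin f `*` basin g)
    (fun (n : nat) (p : Cplx R * Cplx R) =>
       iter (2 * n + 1)%N (skew_map f g) (p.1, iter (n ^ 2)%N (horner g) p.2))
    (fun p => (lavaurs phi psi p.1, 0)).

Proof.
move=> [z0 w0] [/= bz0 bw0].
have [d d0 hd] := uniform_passage hf hg hphi hpsi bz0 bw0.
exists ([set z | modulus (z - z0) < d] `*` [set w | modulus (w - w0) < d]).
  by exists ([set z | modulus (z - z0) < d], [set w | modulus (w - w0) < d]);
    [split; apply/nbhs_modulusP; exists d|].
move=> P /uniform_nbhs[E [entE EP]].
move: entE; rewrite -entourage_ballE => -[e e0 he].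
have eE : e = rC (complex.Re e) /\ 0 < complex.Re e.
  by move: e0; case: (e) => a b; rewrite /= ltcE /= => /andP[/eqP -> a0].
have e2 : 0 < complex.Re e / 2 by rewrite divr_gt0//; case: eE.
apply: filterS (hd _ e2) => n hn; apply: EP => -[z w] [[/= bz bw] [/= zd wd]].
apply: he; have [h1 h2] := hn z w bz zd wd.
case: eE => eE er.
split; rewrite /ball /= eE modulus_lt; last first.
  by rewrite sub0r modulusN; lra.
by rewrite modulus_sym /lavaurs /=; lra.
Qed.
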